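(* Let $k\ge 3$ and $s\ge 1$ be integers, and let \[ c(k,s)=\begin{cases} 3 & \text{if } s=1,\\ \binom{2s+1}{2} & \text{if } k=3,\\ k\binom{s+1}{2} & \text{if } k\ge 4,\ s\ge 2.\end{cases} \] There exists a function $m(n,k,s)=(c(k,s)+o(1))\binom{n}{k-2}$ (as $n\to\infty$) such that for all sufficiently large $n$ the following holds. If $\mathcal{H} \subset \binom{[n]}{k}$ satisfies $\nu(\mathcal{H})\le s$ and $|\mathcal{H}| = m > m(n,k,s)$, then $|\partial\mathcal{H}| \ge |\partial L_{m}EM(n,k,s,1)|$. In particular, if $|\mathcal{H}| = \binom{x}{k} - \binom{x-s}{k} > m(n,k,s)$ for some real $x$, then $|\partial\mathcal{H}| \ge \binom{x}{k-1}$.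
   Context: $[n]=\{1,\dots,n\}$, $\binom{[n]}{k}$ is the family of $k$-subsets of $[n]$. $\nu(\mathcal{H})$ is the matching number: the maximum number of pairwise disjoint members of $\mathcal{H}$. $\partial\mathcal{H}=\{A\in\binom{[n]}{k-1}: A\subset B\text{ for some }B\in\mathcal{H}\}$. Colex order on $\binom{[n]}{k}$: $A\prec B$ iff $\max\big((A\setminus B)\cup(B\setminus A)\big)\in B$; for $\mathcal{F}\subset\binom{[n]}{k}$ and $m\le|\mathcal{F}|$, $L_m\mathcal{F}$ is the set of the first $m$ members of $\mathcal{F}$ in colex order. $EM(n,k,s,1)=\{A\in\binom{[n]}{k}: A\cap[s]\neq\emptyset\}$ (all of $\binom{[n]}{k}$ if $n\le s$). For real $y$ and integer $b\ge0$, $\binom{y}{b}=y(y-1)\cdots(y-b+1)/b!$. *)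

(* Defs.v *)
From HB Require Import structures.
From mathcomp Require Import all_boot all_order all_algebra.
From mathcomp Require Import reals.
Set Implicit Arguments. Unset Strict Implicit. Unset Printing Implicit Defensive.
Import Order.TTheory GRing.Theory Num.Theory.

(* Ground set [n] = {1,...,n} is represented by 'I_n = {0,...,n-1};
   element i+1 of [n] corresponds to ordinal i. *)

Definition pw_disjoint n (M : {set {set 'I_n}}) : bool :=
  [forall A in M, forall B in M, (A != B) ==> [disjoint A & B]].

Definition matching_number n (H : {set {set 'I_n}}) : nat :=
  \max_(M in powerset H | pw_disjoint M) #|M|.

Definition shadow n (k : nat) (H : {set {set 'I_n}}) : {set {set 'I_n}} :=
  [set A : {set 'I_n} | (#|A| == k.-1) && [exists B in H, A \subset B]].

(* colex order: A < B iff max of symmetric difference lies in B,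
   i.e. there is i in B \ A such that A and B agree above i *)
Definition colex_lt n (A B : {set 'I_n}) : bool :=
  [exists i in B :\: A, forall j : 'I_n, (i < j)%N ==> ((j \in A) == (j \in B))].

Definition Lcolex n (m : nat) (F : {set {set 'I_n}}) : {set {set 'I_n}} :=
  [set A in F | #|[set B in F | colex_lt B A]| < m].

Definition EM1 n (k s : nat) : {set {set 'I_n}} :=
  [set A : {set 'I_n} | (#|A| == k) && [exists i in A, (val i < s)%N]].

Definition cks (k s : nat) : nat :=
  if s == 1 then 3 else if k == 3 then 'C(2 * s + 1, 2) else k * 'C(s + 1, 2).

Definition binomr (R : realType) (y : R) (b : nat) : R :=
  (\prod_(i < b) (y - i%:R)) / (b`!)%:R.

(* Main.v *)
Require Import Defs.
From HB Require Import structures.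
From mathcomp Require Import all_boot all_order all_algebra.
From mathcomp Require Import reals perm zify ring lra.
Import Order.TTheory GRing.Theory Num.Theory.
Set Implicit Arguments. Unset Strict Implicit. Unset Printing Implicit Defensive.

(** Compressions reduce to a shifted family H. If H lies in the star family of
    {0, ..., s-1}, one compares with an initial segment of the colex order by
    induction on the least element x of the ground set: the link of x contains the
    shadow of the sets avoiding x, which forces it to be at least as large as the
    link of x in the initial segment, and the shadow of a shifted family has size
    |link| + |shadow of link|. The Lovasz form follows the same induction.

    Otherwise the shadow exceeds |H|/s by a constant factor, whereas initial segments
    of the star family have shadow (1/s + o(1))|H|. Indeed, as H does not contain
    s+1 prescribed disjoint sets, for some t <= s all but
    r(2r+1) C(n,k-2) + O(n^(k-3)) members of H meet {0, ..., t-1}, where r = s-t; the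
    shadow contains the link of 0, which has at least 1/t of the members meeting
    {0, ..., t-1}. For t = 0 this contradicts |H| > s(2s+1) C(n,k-2), and
    c(k,s) >= s(2s+1) in all cases; for 0 < t < s it gives the factor. For t = s,
    some member of H misses {0, ..., s-1}, so the members starting at s-1 have a second
    element below a constant T, and the sets in the shadow containing 0 are at least
    1/T times as many. *)

(** * The colex order *)

Section Colex.
Variable n : nat.
Implicit Types (A B C : {set 'I_n}) (F I : {set {set 'I_n}}).

Lemma colex_ltP A B :
  reflect (exists i, [/\ i \in B, i \notin A &
             forall j : 'I_n, i < j -> (j \in A) = (j \in B)])
          (colex_lt A B).
Proof.
apply: (iffP existsP) => [[i /andP[]]|[i [iB iA h]]].
  rewrite inE => /andP[iA iB] /forallP h; exists i; split=> // j ij.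
  by move: (h j); rewrite ij /= => /eqP.
exists i; rewrite inE iA iB /=; apply/forallP => j; apply/implyP => ij.
by rewrite h.
Qed.

(** The integer with binary digit set A. Comparing weights amounts to comparing in colex order, and
    the total weight of a family is the measure that compressions decrease. *)
Definition weight A := \sum_(i in A) 2 ^ i.

Lemma sum_pow2_lt v : v <= n -> \sum_(j < n | j < v) 2 ^ j < 2 ^ v.
Proof.
move=> vn; rewrite -(big_ord_widen n (fun j => 2 ^ j) vn).
by have := predn_exp 2 v; rewrite mul1n => <-; rewrite prednK ?expn_gt0.
Qed.

Lemma colex_lt_weight_lt A B : colex_lt A B -> weight A < weight B.
Proof.
case/colex_ltP=> i [iB iA h]; rewrite /weight.
rewrite (bigID (fun j : 'I_n => i < j)) /= [X in _ < X](bigID (fun j : 'I_n => i < j)) /=.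
have -> : \sum_(j in A | i < j) 2 ^ j = \sum_(j in B | i < j) 2 ^ j.
  apply: eq_bigl => j; case: (ltnP i j) => [/h ->|]; by rewrite ?andbF.
rewrite ltn_add2l (bigD1 (P := fun j => (j \in B) && ~~ (i < j)) i) /=; last by rewrite iB ltnn.
apply: leq_trans (leq_addr _ _).
apply: leq_ltn_trans (sum_pow2_lt (ltnW (ltn_ord i))).
rewrite big_mkcond [X in _ <= X]big_mkcond; apply: leq_sum => j _.
case: ifP => //= /andP[jA]; rewrite -leqNgt leq_eqVlt => /orP[/eqP/val_inj ji|-> //].
by rewrite ji (negbTE iA) in jA.
Qed.

Lemma colex_total A B : A != B -> colex_lt A B || colex_lt B A.
Proof.
move=> AB; have [i0 i0P] : exists i, (i \in A) != (i \in B).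
  apply/existsP; rewrite -negb_forall; apply: contra AB => /forallP h.
  by apply/eqP/setP => i; apply/eqP/h.
case: (@arg_maxnP _ i0 (fun i => (i \in A) != (i \in B)) val i0P) => i iP imax.
have h (j : 'I_n) : i < j -> (j \in A) = (j \in B).
  by move=> ij; apply/eqP; apply: contraLR ij => /imax; rewrite -leqNgt.
case iA: (i \in A); case iB: (i \in B); rewrite iA iB // in iP.
  apply/orP; right; apply/colex_ltP; exists i; rewrite iA iB; split=> // j /h ->//.
by apply/orP; left; apply/colex_ltP; exists i; rewrite iA iB; split=> // j /h.
Qed.

Lemma colex_ltE A B : colex_lt A B = (weight A < weight B).
Proof.
apply/idP/idP => [/colex_lt_weight_lt //|lt].
have /colex_total/orP[//|/colex_lt_weight_lt] : A != B.
  by apply: contraTneq lt => ->; rewrite ltnn.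
by rewrite ltnNge (ltnW lt).
Qed.

(** Stated as downward closure, without a cardinality, so that links and deletions inherit it in the
    induction on the least point. *)
Definition initial_segment F I :=
  I \subset F /\ forall A B, B \in I -> A \in F -> colex_lt A B -> A \in I.

Lemma Lcolex_initial m F : initial_segment F (Lcolex m F).
Proof.
split=> [|A B]; first by apply/subsetP => A; rewrite inE => /andP[].
rewrite !inE => /andP[_ ltm] -> /= AB; apply: leq_ltn_trans ltm.
apply/subset_leq_card/subsetP => C; rewrite !inE => /andP[-> /=].
by move: AB; rewrite !colex_ltE => AB CA; apply: ltn_trans AB.
Qed.

(** The colex rank [rk] is injective on F and below m on [Lcolex m F]. *)
Lemma card_Lcolex m F : #|Lcolex m F| <= m.
Proof.
pose rk A := #|[set B in F | colex_lt B A]|.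
have rk_mono A B : A \in F -> colex_lt A B -> rk A < rk B.
  move=> AF AB; apply/proper_card/properP; split.
    apply/subsetP => C; rewrite !inE => /andP[-> /=].
    by move: AB; rewrite !colex_ltE => AB CA; apply: ltn_trans AB.
  by exists A; rewrite !inE ?AF //= colex_ltE ltnn.
rewrite cardE -(size_map rk) -[X in _ <= X](size_iota 0) uniq_leq_size //.
  rewrite map_inj_in_uniq ?enum_uniq // => A B.
  rewrite !mem_enum !inE => /andP[AF _] /andP[BF _] eqrk.
  apply: contra_eq eqrk => /colex_total/orP[] lt.
    by rewrite neq_ltn rk_mono.
  by rewrite neq_ltn orbC rk_mono.
move=> r /mapP[A]; rewrite mem_enum inE => /andP[_ ltm] ->.
by rewrite mem_iota.
Qed.

End Colex.

(** * Links, shadows and the Kruskal-Katona theorem for star families *)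

Section LinkShadow.
Variable n : nat.
Implicit Types (x y : 'I_n) (A B C D : {set 'I_n}) (H I : {set {set 'I_n}}).

Definition uniform k H := forall A, A \in H -> #|A| = k.

Lemma shadowP k H C :
  reflect (#|C| = k.-1 /\ exists2 B, B \in H & C \subset B) (C \in shadow k H).
Proof.
rewrite inE; apply: (iffP andP) => [[/eqP-> /exists_inP[B BH CB]]|[-> [B BH CB]]].
  by split=> //; exists B.
by split=> //; apply/exists_inP; exists B.
Qed.

Lemma shadow_setD1 k H A x : uniform k H -> A \in H -> x \in A -> A :\ x \in shadow k H.
Proof.
move=> uH AH xA; apply/shadowP; split; last by exists A; rewrite ?subD1set.
by rewrite -(uH _ AH) (cardsD1 x A) xA.
Qed.

Lemma shadow_setU1 k H C : 0 < k -> uniform k H -> C \in shadow k H ->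
  exists2 y, y \notin C & y |: C \in H.
Proof.
move=> k0 uH /shadowP[cC [B BH CB]].
have /cards1P[y yE] : #|B :\: C| == 1.
  by rewrite cardsD (setIidPr CB) cC (uH _ BH) -[k in k - _]prednK // subSnn.
have : y \in B :\: C by rewrite yE set11.
rewrite inE => /andP[yC _]; exists y => //.
suff -> : y |: C = B by [].
by rewrite -yE setDE setUC setUIr setUCr setIT; apply/setUidPr.
Qed.

Definition lnk x H := [set C : {set 'I_n} | (x \notin C) && (x |: C \in H)].
Definition del x H := [set A in H | x \notin A].

Lemma setD1_lnk x H A : A \in H -> x \in A -> A :\ x \in lnk x H.
Proof. by move=> AH xA; rewrite inE setD11 setD1K. Qed.

Lemma card_lnk x H : #|lnk x H| = #|[set A : {set 'I_n} in H | x \in A]|.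
Proof.
have <- : [set x |: C | C in lnk x H] = [set A : {set 'I_n} in H | x \in A].
  apply/setP => A; apply/imsetP/idP => [[C]|].
    by rewrite inE => /andP[xC CH] ->; rewrite inE CH setU11.
  rewrite inE => /andP[AH xA]; exists (A :\ x); last by rewrite setD1K.
  exact: setD1_lnk.
rewrite card_in_imset // => C D; rewrite !inE => /andP[xC _] /andP[xD _] e.
by rewrite -(setU1K xC) e setU1K.
Qed.

Lemma card_lnk_del x H : #|H| = #|lnk x H| + #|del x H|.
Proof.
rewrite card_lnk -(cardsID [set A : {set 'I_n} | x \in A] H); congr (_ + _).
  by apply: eq_card => A; rewrite !inE.
by apply: eq_card => A; rewrite !inE andbC.
Qed.

Lemma lnk_uniform k x H : uniform k H -> uniform k.-1 (lnk x H).
Proof.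
move=> uH C; rewrite inE => /andP[xC /uH <-].
by rewrite cardsU1 xC.
Qed.

Lemma del_uniform k x H : uniform k H -> uniform k (del x H).
Proof. by move=> uH A; rewrite inE => /andP[/uH]. Qed.

(** The link lies in the part of the shadow avoiding x; adding x to a set in the shadow of the link
    gives a shadow set containing x. *)
Lemma shadow_ge k x H : 1 < k -> uniform k H ->
  #|lnk x H| + #|shadow k.-1 (lnk x H)| <= #|shadow k H|.
Proof.
move=> k1 uH; rewrite (card_lnk_del x (shadow k H)) addnC.
apply: leq_add; apply/subset_leq_card/subsetP => C.
  move=> /(shadow_setU1 _ (lnk_uniform uH)) -[|y yC]; first by lia.
  rewrite inE => /andP[xyC xyH].
  have [xC xy] : x \notin C /\ x != y.
    by move: xyC; rewrite !inE negb_or => /andP[].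
  rewrite inE xC /=.
  have -> : x |: C = (x |: (y |: C)) :\ y.
    apply/setP => z; rewrite !inE; case: (eqVneq z y) => [->|] //=.
    by rewrite eq_sym (negbTE xy) (negbTE yC).
  by apply: shadow_setD1; rewrite // !inE eqxx orbT.
rewrite !inE => /andP[xC xCH]; rewrite xC andbT.
have := shadow_setD1 uH xCH (setU11 _ _).
by rewrite setU1K // inE.
Qed.

(** A shadow set avoiding x arises by deleting x, which puts it in the link, or from a member
    avoiding x, where the hypothesis applies. *)
Lemma shadow_le k x H : 1 < k -> uniform k H ->
  shadow k (del x H) \subset lnk x H ->
  #|shadow k H| <= #|lnk x H| + #|shadow k.-1 (lnk x H)|.
Proof.
move=> k1 uH /subsetP dH; rewrite (card_lnk_del x (shadow k H)) addnC.
apply: leq_add; apply/subset_leq_card/subsetP => C.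
  rewrite inE => /andP[/shadow_setU1 -/(_ (ltnW k1) uH)[y yC yCH] xC].
  case: (eqVneq y x) => [e|yx]; first by rewrite inE xC -e.
  apply: dH; rewrite -(setU1K yC); apply: shadow_setD1; last exact: setU11.
    exact: del_uniform.
  by rewrite !inE yCH negb_or eq_sym yx.
rewrite inE => /andP[xC /shadow_setU1 -/(_ (ltnW k1) uH)[y yC yCH]].
have [yx yC'] : y != x /\ y \notin C.
  by move: yC; rewrite !inE negb_or => /andP[].
rewrite -(setU1K yC'); apply: shadow_setD1; last exact: setU11.
  exact: lnk_uniform.
by rewrite !inE negb_or eq_sym yx xC /= setUCA.
Qed.

(** The bound p lets the property pass to links and deletions of the point p, with p+1 in place of
    p. *)
Definition shifted_from p H := forall A (i j : 'I_n),
  A \in H -> p <= i -> i < j -> j \in A -> i \notin A -> i |: (A :\ j) \in H.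

Lemma lnk_shifted x H : shifted_from x H -> shifted_from x.+1 (lnk x H).
Proof.
move=> sH A i j; rewrite !inE => /andP[xA AH] xi ij jA iA.
have ix : x != i by rewrite neq_ltn xi.
have jx : x != j by rewrite neq_ltn (ltn_trans xi).
rewrite negb_or ix negb_and negbK eq_sym eq_sym (negbTE jx) (negbTE xA) /=.
have -> : x |: (i |: A :\ j) = i |: ((x |: A) :\ j).
  apply/setP => z; rewrite !inE; case: (eqVneq z x) => [->|] //=.
  by rewrite jx orbT.
by apply: sH; rewrite ?(ltnW xi) // !inE ?jA ?orbT // negb_or iA eq_sym ix.
Qed.

Lemma del_shifted x H : shifted_from x H -> shifted_from x.+1 (del x H).
Proof.
move=> sH A i j; rewrite !inE => /andP[AH xA] xi ij jA iA.
rewrite sH ?(ltnW xi) //= negb_or (negbTE xA) andbF andbT.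
by rewrite neq_ltn xi.
Qed.

Definition above p A := [forall i in A, p <= i].

Lemma aboveP p A : reflect (forall i, i \in A -> p <= i) (above p A).
Proof. exact: forall_inP. Qed.

(** If [y |: C] is a member avoiding x, then y > x, and shifting y down to x yields [x |: C]. *)
Lemma shadow_del_lnk k x H : 0 < k -> uniform k H -> shifted_from x H ->
  (forall A, A \in H -> above x A) -> shadow k (del x H) \subset lnk x H.
Proof.
move=> k0 uH sH aH; apply/subsetP => C.
move=> /(shadow_setU1 k0 (del_uniform uH))[y yC].
rewrite !inE negb_or => /andP[yCH /andP[xy xC]]; rewrite xC /=.
rewrite -[C in x |: C](setU1K yC); apply: sH; rewrite ?setU11 //.
  rewrite ltn_neqAle xy /=; apply: (aboveP _ _ (aH _ yCH)); exact: setU11.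
by rewrite !inE negb_or xy.
Qed.

Lemma above_lnk x H C : (forall A, A \in H -> above x A) -> C \in lnk x H -> above x.+1 C.
Proof.
move=> aH; rewrite inE => /andP[xC CH]; apply/aboveP => i iC.
rewrite ltn_neqAle; apply/andP; split.
  by apply: contraNneq xC => /val_inj ->.
by apply: (aboveP _ _ (aH _ CH)); rewrite !inE iC orbT.
Qed.

Lemma above_del x H C : (forall A, A \in H -> above x A) -> C \in del x H -> above x.+1 C.
Proof.
move=> aH; rewrite inE => /andP[CH xC]; apply/aboveP => i iC.
rewrite ltn_neqAle; apply/andP; split.
  by apply: contraNneq xC => /val_inj ->.
exact: (aboveP _ _ (aH _ CH)).
Qed.

(* [EM1 n k s] restricted to the subsets of {p, ..., n-1}; for s >= n this is the
   family of all k-subsets, so the Kruskal-Katona theorem is a special case. *)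
Definition EMfrom p k s := [set A in EM1 n k s | above p A].

Lemma EMfromP p k s A :
  reflect [/\ #|A| = k, exists2 i, i \in A & i < s & above p A] (A \in EMfrom p k s).
Proof.
rewrite !inE; apply: (iffP idP) => [/andP[/andP[/eqP-> /exists_inP[i iA si]] aA]|].
  by split=> //; exists i.
case=> -> [i iA si] ->; rewrite eqxx andbT /=; apply/exists_inP; by exists i.
Qed.

Lemma colex_setU1 x A B : x \notin B -> colex_lt A B -> colex_lt (x |: A) (x |: B).
Proof.
move=> xB /colex_ltP[i [iB iA h]]; apply/colex_ltP; exists i.
have ix : i != x by apply: contraNneq xB => <-.
split; rewrite ?inE ?iB ?orbT ?negb_or ?ix //.
by move=> j /h; rewrite !inE => ->.
Qed.

Lemma colex_swap A (i j : 'I_n) : i < j -> j \in A -> i \notin A -> colex_lt (i |: A :\ j) A.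
Proof.
move=> ij jA iA; apply/colex_ltP; exists j; split=> // [|l jl].
  by rewrite !inE eqxx orbF neq_ltn ij orbT.
rewrite !inE; have -> : (l == i) = false by apply/negbTE; rewrite neq_ltn (ltn_trans ij jl) orbT.
by have -> : l != j by rewrite neq_ltn jl orbT.
Qed.

Lemma card_swap A (i j : 'I_n) : j \in A -> i \notin A -> #|i |: A :\ j| = #|A|.
Proof.
move=> jA iA; rewrite cardsU1 !inE negb_and iA orbT [RHS](cardsD1 j) jA.
by [].
Qed.

Lemma EMfrom_swap p k s A (i j : 'I_n) : A \in EMfrom p k s ->
  p <= i -> i < j -> j \in A -> i \notin A -> i |: A :\ j \in EMfrom p k s.
Proof.
move=> /EMfromP[cA [l lA ls] aA] pi ij jA iA; apply/EMfromP; split.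
- by rewrite card_swap.
- case: (eqVneq l j) => [e|lj].
    by exists i; rewrite ?setU11 //; apply: leq_trans ls; rewrite e ltnW.
  by exists l => //; rewrite !inE lj lA orbT.
- apply/aboveP => y; rewrite !inE => /orP[/eqP-> //|/andP[_ yA]].
  exact: (aboveP _ _ aA).
Qed.

Lemma initial_shifted p k s I : initial_segment (EMfrom p k s) I -> shifted_from p I.
Proof.
move=> [/subsetP IE init] A i j AI pi ij jA iA.
by apply: (init _ A) => //; [apply: EMfrom_swap; rewrite ?IE | apply: colex_swap].
Qed.

Lemma EMfrom_uniform p k s H : H \subset EMfrom p k s -> uniform k H.
Proof. by move=> /subsetP HE A /HE/EMfromP[]. Qed.

Lemma EMfrom_above p k s H : H \subset EMfrom p k s -> forall A, A \in H -> above p A.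
Proof. by move=> /subsetP HE A /HE/EMfromP[]. Qed.

Lemma del_EMfrom x k s H : H \subset EMfrom x k s -> del x H \subset EMfrom x.+1 k s.
Proof.
move=> HE; apply/subsetP => A AH; apply/EMfromP.
have AH' : A \in H by move: AH; rewrite inE => /andP[].
have /EMfromP[cA eA _] := subsetP HE _ AH'.
by split=> //; apply: above_del AH; apply: EMfrom_above HE.
Qed.

Lemma lnk_EMfrom x k s H : 1 < k -> H \subset EMfrom x k s ->
  lnk x H \subset EMfrom x.+1 k.-1 n.
Proof.
move=> k1 HE; apply/subsetP => C CH; apply/EMfromP.
have cC : #|C| = k.-1 by apply: lnk_uniform CH; apply: EMfrom_uniform HE.
split=> //; last by apply: above_lnk CH; apply: EMfrom_above HE.
have /card_gt0P[i iC] : 0 < #|C| by rewrite cC; lia.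
by exists i.
Qed.

(** Since x < s, the set [x |: C] meets the star condition for every C. The link is thus a segment
    among all (k-1)-sets above x, encoded by replacing s with n. *)
Lemma lnk_initial x k s I : 1 < k -> x < s -> initial_segment (EMfrom x k s) I ->
  initial_segment (EMfrom x.+1 k.-1 n) (lnk x I).
Proof.
move=> k1 xs [IE init]; split; first exact: lnk_EMfrom IE.
move=> D C CI /EMfromP[cD _ aD] DC.
have xD : x \notin D by apply/negP => /(aboveP _ _ aD); rewrite ltnn.
move: (CI); rewrite !inE => /andP[xC xCI]; rewrite xD /=.
apply: init xCI _ (colex_setU1 xC DC); apply/EMfromP; split.
- by rewrite cardsU1 xD cD; lia.
- by exists x; rewrite ?setU11.
- apply/aboveP => i; rewrite !inE => /orP[/eqP-> //|/(aboveP _ _ aD)]; exact: ltnW.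
Qed.

Lemma del_initial x k s I : initial_segment (EMfrom x k s) I ->
  initial_segment (EMfrom x.+1 k s) (del x I).
Proof.
move=> [IE init]; split; first exact: del_EMfrom IE.
move=> A B; rewrite [B \in _]inE => /andP[BI _] /EMfromP[cA eA aA] AB.
rewrite inE; have -> : x \notin A by apply/negP => /(aboveP _ _ aA); rewrite ltnn.
rewrite (init _ B) //; apply/EMfromP; split=> //.
by apply/aboveP => i /(aboveP _ _ aA); apply: ltnW.
Qed.

(* Among the k-sets avoiding x and lying above it, the first one in colex order after
   [x |: C] is [z |: C], z being the least element outside C. *)
Lemma lnk_sub_shadow_next x k s I B : 1 < k -> initial_segment (EMfrom x k s) I ->
  B \in EMfrom x.+1 k s -> B \notin del x I ->
  (forall A, A \in EMfrom x.+1 k s -> colex_lt A B -> A \in del x I) ->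
  lnk x I \subset shadow k (B |: del x I).
Proof.
move=> k1 [IE init] BE BI minB; apply/subsetP => C CI.
have /EMfromP[cB [i0 i0B i0s] aB] := BE.
have cC : #|C| = k.-1 by apply: lnk_uniform CI; apply: EMfrom_uniform IE.
have aC : above x.+1 C by apply: above_lnk CI; apply: EMfrom_above IE.
have xB : x \notin B by apply/negP => /(aboveP _ _ aB); rewrite ltnn.
have [z0 z0P] : exists z0, (z0 \notin C) && (x < z0).
  have /subsetPn[z zB zC] : ~~ (B \subset C).
    by apply/negP => /subset_leq_card; rewrite cB cC; lia.
  by exists z; rewrite zC (aboveP _ _ aB).
case: (@arg_minnP _ z0 (fun z => (z \notin C) && (x < z)) val z0P) => z /andP[zC xz] zmin.
have low (j : 'I_n) : x < j -> j < z -> j \in C.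
  by move=> xj jz; apply: contraLR jz => jC; rewrite -leqNgt; apply: zmin; rewrite jC.
pose D := z |: C.
have cD : #|D| = k by rewrite cardsU1 zC cC; lia.
have DE : D \in EMfrom x.+1 k s.
  apply/EMfromP; split=> //.
    have [i0C|i0C] := boolP (i0 \in C); first by exists i0; rewrite // !inE i0C orbT.
    exists z; first exact: setU11.
    by apply: leq_ltn_trans i0s; apply: zmin; rewrite i0C (aboveP _ _ aB).
  by apply/aboveP => i; rewrite !inE => /orP[/eqP-> //|/(aboveP _ _ aC)].
suff DI : D \in B |: del x I.
  apply/shadowP; split=> //; exists D => //; exact: subsetUr.
rewrite in_setU1; case: eqVneq => //= /colex_total/orP[/minB -> //|BD].
(* If B preceded D it would also precede [x |: C], hence lie in I: the point i deciding between B
   and D is above z, since otherwise B would be contained in D and equal to it. *)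
case/negP: BI; rewrite inE xB andbT.
have /EMfromP[_ _ aD] := DE.
move: (CI); rewrite inE => /andP[xC xCI]; apply: init xCI _ _.
  apply/EMfromP; split=> //; first by exists i0.
  by apply/aboveP => i /(aboveP _ _ aB); apply: ltnW.
have /colex_ltP[i [iD iB h]] := BD.
have [iz|zi] := leqP i z.
  have BsD : B \subset D.
    apply/subsetP => j jB; case: (ltngtP i j) => [/h <- //|ji|/val_inj <- //].
    by rewrite !inE low ?orbT ?(leq_trans ji) //; apply: (aboveP _ _ aB).
  have /eqP BD' : B == D by rewrite eqEcard BsD cB cD leqnn.
  by rewrite BD' iD in iB.
apply/colex_ltP; exists i; split=> //.
  by move: iD; rewrite !inE; case: eqVneq zi => [->|_ _ /= ->]; rewrite ?ltnn // orbT.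
move=> j ij; rewrite (h _ ij) !inE.
have jz : j != z by rewrite neq_ltn (ltn_trans zi) ?orbT.
have xj : x < j by apply: ltn_trans xz (ltn_trans zi ij).
by rewrite (negbTE jz); case: eqVneq xj => // ->; rewrite ltnn.
Qed.

Lemma initial_setU1 F I B : initial_segment F I -> B \in F ->
  (forall A, A \in F -> colex_lt A B -> A \in I) -> initial_segment F (B |: I).
Proof.
move=> [IF init] BF minB; split=> [|A C]; first by rewrite subUset sub1set BF.
rewrite in_setU1 => /orP[/eqP->|CI] AF AC; rewrite in_setU1.
  by rewrite minB ?orbT.
by rewrite (init _ C) ?orbT.
Qed.

Lemma EMfrom_eq0 p k s : s <= p -> EMfrom p k s = set0.
Proof.
move=> sp; apply/setP => A; rewrite in_set0; apply/negP.
move=> /EMfromP[_ [i iA si] /aboveP/(_ _ iA) pi].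
by have := leq_trans si (leq_trans sp pi); rewrite ltnn.
Qed.

Lemma EMfrom_ge p k s : n <= p -> EMfrom p k s = set0.
Proof.
move=> np; apply/setP => A; rewrite in_set0; apply/negP.
move=> /EMfromP[_ [i iA _] /aboveP/(_ _ iA) pi].
by have := leq_trans (ltn_ord i) (leq_trans np pi); rewrite ltnn.
Qed.

Lemma shadow0 k : shadow k (set0 : {set {set 'I_n}}) = set0.
Proof.
by apply/setP => C; rewrite in_set0; apply/negP => /shadowP[_ [B]]; rewrite inE.
Qed.

Lemma shadow1_gt0 H : 0 < #|H| -> 0 < #|shadow 1 H|.
Proof.
move=> /card_gt0P[A AH]; apply/card_gt0P; exists set0; apply/shadowP.
by rewrite cards0; split=> //; exists A; rewrite ?sub0set.
Qed.

Lemma card_shadow1 H : #|shadow 1 H| <= 1.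
Proof.
rewrite -[X in _ <= X](cards1 (set0 : {set 'I_n})); apply/subset_leq_card/subsetP => C.
by move=> /shadowP[cC _]; rewrite inE -cards_eq0 cC.
Qed.

(** Induction on n - p with x = p. By [shadow_le] for I and [shadow_ge] for H, it suffices to
    compare the links of x; the induction hypothesis then compares their shadows. *)
Theorem Kruskal_Katona_EMfrom p k s H I :
  H \subset EMfrom p k s -> shifted_from p H ->
  initial_segment (EMfrom p k s) I -> #|I| <= #|H| ->
  #|shadow k I| <= #|shadow k H|.
Proof.
have [d] := ubnP (n - p); elim: d p k s H I => // d IHd p k s H I dp HE sH initI IH.
have [I0|Ipos] := posnP #|I|; first by rewrite (cards0_eq I0) shadow0 cards0.
have [A AI] := card_gt0P Ipos.
have AE := subsetP initI.1 _ AI.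
have pn : p < n by rewrite ltnNge; apply/negP => /EMfrom_ge e; rewrite e inE in AE.
have ps : p < s by rewrite ltnNge; apply/negP => /EMfrom_eq0 e; rewrite e inE in AE.
have [k1|k1] := leqP k 1.
  have k_eq1 : k = 1.
    case/EMfromP: AE => <- [i iA _] _ in k1 *.
    by apply/eqP; rewrite eqn_leq k1; apply/card_gt0P; exists i.
  rewrite k_eq1; apply: leq_trans (card_shadow1 _) _.
  exact/shadow1_gt0/(leq_trans Ipos).
pose x := Ordinal pn.
have uI := EMfrom_uniform initI.1; have uH := EMfrom_uniform HE.
have subH : shadow k (del x H) \subset lnk x H.
  by apply: shadow_del_lnk => //; [lia | apply: EMfrom_above HE].
have subI : shadow k (del x I) \subset lnk x I.
  apply: shadow_del_lnk => //; first by lia.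
    exact: initial_shifted initI.
  exact: EMfrom_above initI.1.
have dn : n - p.+1 < d by lia.
have lnkIH : #|lnk x I| <= #|lnk x H|.
  (* If the link of I were larger, more members of H than of I would avoid x, so the induction
     hypothesis would apply to [del x I] enlarged by its colex successor B. The shadow of this
     enlargement contains the link of I, and the shadow of [del x H] lies in the link of H: a
     contradiction. *)
  rewrite leqNgt; apply/negP => lt.
  have del_lt : #|del x I| < #|del x H|.
    by move: IH lt; rewrite (card_lnk_del x I) (card_lnk_del x H); lia.
  have [B0 B0P] : exists B, B \in EMfrom p.+1 k s :\: del x I.
    have dHE := del_EMfrom (x := x) HE.
    have /subsetPn[B BH BI] : ~~ (del x H \subset del x I).
      by apply/negP => /subset_leq_card; rewrite leqNgt del_lt.
    by exists B; rewrite inE BI (subsetP dHE).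
  case: (@arg_minnP _ B0 (mem (EMfrom p.+1 k s :\: del x I)) (@weight n) B0P) => B.
  move=> /setDP[BE BI] Bmin.
  have minB C : C \in EMfrom p.+1 k s -> colex_lt C B -> C \in del x I.
    move=> CE; rewrite colex_ltE; apply: contraLR => CI; rewrite -leqNgt.
    by apply: Bmin; apply/setDP.
  have := IHd p.+1 k s (del x H) (B |: del x I) dn (del_EMfrom (x := x) HE) (@del_shifted x H sH).
  move=> /(_ (initial_setU1 (del_initial (x := x) initI) BE minB)).
  rewrite cardsU1 BI => /(_ del_lt) le1.
  have le2 := subset_leq_card (lnk_sub_shadow_next (x := x) k1 initI BE BI minB).
  have := leq_trans le2 (leq_trans le1 (subset_leq_card subH)).
  by rewrite leqNgt lt.
apply: leq_trans (shadow_le k1 uI subI) (leq_trans _ (shadow_ge x k1 uH)).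
rewrite leq_add //; apply: IHd dn _ _ _ lnkIH.
- exact: (lnk_EMfrom (x := x)) HE.
- exact: (@lnk_shifted x).
- exact: (lnk_initial (x := x)) initI.
Qed.

End LinkShadow.

(** * Compressions *)

Section Compression.
Variable n : nat.
Variables i j : 'I_n.
Hypothesis ij : i < j.
Implicit Types (A B C D : {set 'I_n}) (H M : {set {set 'I_n}}).

Let sw A : {set 'I_n} := tperm i j @: A.

Lemma in_sw A z : (z \in sw A) = (tperm i j z \in A).
Proof. by rewrite -{1}(tpermK i j z) mem_imset //; apply: perm_inj. Qed.

Lemma swK : involutive sw.
Proof. by move=> A; apply/setP => z; rewrite !in_sw tpermK. Qed.

Lemma card_sw A : #|sw A| = #|A|.
Proof. by rewrite card_imset //; apply: perm_inj. Qed.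

Lemma sw_neutral A : (i \in A) = (j \in A) -> sw A = A.
Proof.
by move=> e; apply/setP => z; rewrite in_sw; case: tpermP => // ->.
Qed.

Lemma sw_swap A : j \in A -> i \notin A -> sw A = i |: A :\ j.
Proof.
move=> jA iA; apply/setP => z; rewrite in_sw !inE; case: tpermP => [->|->|].
- by rewrite eqxx jA.
- by rewrite (negbTE iA) eqxx orbF; apply/esym/negbTE; rewrite neq_ltn ij orbT.
- by move=> /eqP/negbTE-> /eqP->.
Qed.

Lemma subset_sw A B : A \subset B -> sw A \subset sw B.
Proof. exact: imsetS. Qed.

(** The (i,j)-compression, written as a membership test: of a pair A, [sw A], the set with i and
    without j is kept if either was in H, its partner only if both were. *)
Definition compress H := [set A : {set 'I_n} |
  if (j \in A) && (i \notin A) then (A \in H) && (sw A \in H)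
  else if (i \in A) && (j \notin A) then (A \in H) || (sw A \in H)
  else A \in H].

Lemma sw_i A : (i \in sw A) = (j \in A). Proof. by rewrite in_sw tpermL. Qed.
Lemma sw_j A : (j \in sw A) = (i \in A). Proof. by rewrite in_sw tpermR. Qed.

Lemma compress_pair H A :
  (A \in compress H) + (sw A \in compress H) = (A \in H) + (sw A \in H).
Proof.
rewrite !inE swK sw_i sw_j; case iA: (i \in A); case jA: (j \in A) => //=;
  by case: (A \in H); case: (sw A \in H).
Qed.

(** Doubling allows checking sums pair by pair on A, [sw A] without choosing representatives. *)
Lemma sum_sw (f : {set 'I_n} -> nat) :
  (\sum_A f A).*2 = \sum_A (f A + f (sw A)).
Proof.
rewrite big_split /= -addnn; congr (_ + _).
by rewrite (reindex_inj (can_inj swK)).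
Qed.

Lemma card_sum (T : finType) (F : {set T}) : #|F| = \sum_x (x \in F : nat).
Proof. by rewrite -sum1_card big_mkcond; apply: eq_bigr => x _; case: (x \in F). Qed.

Lemma card_compress H : #|compress H| = #|H|.
Proof.
apply: double_inj; rewrite !card_sum !sum_sw.
by apply: eq_bigr => A _; apply: compress_pair.
Qed.

Lemma compress_uniform k H : uniform k H -> uniform k (compress H).
Proof.
move=> uH A; rewrite inE; case: ifP => _; first by case/andP=> /uH.
case: ifP => _; last exact: uH.
by case/orP=> /uH //; rewrite card_sw.
Qed.

(** Cases on which of i, j lie in C, then on whether the added point y is one of them. Where [sw C]
    is needed in the shadow, it lies below [sw B], which is in H or equals B. *)
Lemma shadow_compress k H : 0 < k -> uniform k H ->
  shadow k (compress H) \subset compress (shadow k H).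
Proof.
move=> k0 uH; apply/subsetP => C CS.
have [y yC yCS] := shadow_setU1 k0 (compress_uniform uH) CS.
have cC : #|C| = k.-1 by case/shadowP: CS.
set B := y |: C in yCS.
have CB : C \subset B by apply: subsetUr.
have shC (D E : {set 'I_n}) : #|D| = k.-1 -> D \subset E -> E \in H -> D \in shadow k H.
  by move=> cD DE EH; apply/shadowP; split=> //; exists E.
have inB z : (z \in B) = (z == y) || (z \in C) by rewrite !inE.
have cS : #|sw C| = k.-1 by rewrite card_sw.
have sCB : sw C \subset sw B by apply: subset_sw.
have hi := inB i; have hj := inB j.
move: yCS; rewrite [B \in _]inE [C \in _]inE.
case iC: (i \in C) hi => hi; case jC: (j \in C) hj => hj;
  rewrite ?orbT in hi hj; rewrite hi hj /=.
- exact: shC.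
- case: (j == y) hj => /= hj; rewrite ?hj /=.
    by move=> BH; apply/orP; left; apply: shC BH.
  by move=> /orP[BH|BH]; apply/orP; [left|right]; apply: shC BH.
- case: (i == y) hi => /= hi; rewrite ?hi /=.
    move=> BH; have e : sw B = B by apply: sw_neutral; rewrite hi hj.
    by rewrite (shC _ _ cC CB BH) (shC _ _ cS _ BH) // -e.
  by case/andP=> BH sBH; rewrite (shC _ _ cC CB BH) (shC _ _ cS sCB sBH).
- have e : sw C = C by apply: sw_neutral; rewrite iC jC.
  rewrite e in sCB.
  case: ifP => _; first by case/andP=> BH _; apply: shC BH.
  case: ifP => _; last exact: shC.
  by case/orP; apply: shC.
Qed.

(** A matching M of the compression not inside H has a member B containing i whose swap is in H. The
    other members avoid i, so they are fixed by [sw] or have their swap in H; hence the image of M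
    under [sw] is a matching in H. *)
Lemma matching_compress H : matching_number (compress H) <= matching_number H.
Proof.
apply/bigmax_leqP => M /andP[]; rewrite powersetE => /subsetP MS dM.
have disj A B z : A \in M -> B \in M -> z \in A -> z \in B -> A = B.
  move=> AM BM zA zB; apply/eqP; apply: contraTT dM => AB.
  apply/negP => /forall_inP/(_ A AM)/forall_inP/(_ B BM); rewrite AB /=.
  by move=> /pred0P/(_ z); rewrite /= zA zB.
have leM M' : M' \subset H -> pw_disjoint M' -> #|M'| <= matching_number H.
  by move=> M'H dM'; apply: (@leq_bigmax_cond _ _ (fun M => #|M|)); rewrite powersetE M'H.
have [MH|/subsetPn[B BM BH]] := boolP (M \subset H); first exact: leM.
rewrite -(card_imset _ (can_inj swK)); apply: leM.
  have [iB jB sBH] : [/\ i \in B, j \notin B & sw B \in H].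
    move: (MS _ BM); rewrite inE (negbTE BH) /=; case: ifP => // _.
    by case: ifP => // /andP[].
  apply/subsetP => _ /imsetP[A AM ->]; have [-> //|AB] := eqVneq A B.
  have iA : i \notin A by apply: contra AB => iA; apply/eqP/(disj _ _ i).
  move: (MS _ AM); rewrite inE (negbTE iA) andbT /=.
  case jA: (j \in A) => /=; first by case/andP.
  by rewrite sw_neutral // (negbTE iA) jA.
apply/forall_inP => _ /imsetP[A AM ->]; apply/forall_inP => _ /imsetP[A' AM' ->].
apply/implyP => AA'; apply/pred0P => z /=; rewrite !in_sw.
apply/negP => /andP[zA zA']; case/negP: AA'.
by rewrite (disj _ _ _ AM AM' zA zA').
Qed.

Lemma weight_sw A : j \in A -> i \notin A -> weight (sw A) < weight A.
Proof. by move=> jA iA; rewrite sw_swap // -colex_ltE colex_swap. Qed.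

(** No pair A, [sw A] gains weight, and the given pair loses some, as A is replaced by the lighter
    [sw A]. *)
Lemma weight_compress H A : A \in H -> j \in A -> i \notin A -> sw A \notin H ->
  \sum_(B in compress H) weight B < \sum_(B in H) weight B.
Proof.
move=> AH jA iA sAH; rewrite -ltn_double big_mkcond [X in _ < X.*2]big_mkcond !sum_sw.
have term B : (if B \in compress H then weight B else 0)
    + (if sw B \in compress H then weight (sw B) else 0)
    <= (if B \in H then weight B else 0) + (if sw B \in H then weight (sw B) else 0).
  rewrite !inE swK sw_i sw_j.
  case iB: (i \in B); case jB: (j \in B) => //=;
    case BH: (B \in H); case sBH: (sw B \in H) => //=; rewrite ?addn0 ?add0n //.
    apply: ltnW; rewrite -{1}(swK B); apply: weight_sw; by rewrite ?sw_i ?sw_j ?jB ?iB.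
  by apply/ltnW/weight_sw; rewrite ?iB.
rewrite (bigD1 A) //= [X in _ < X](bigD1 A) //= -addSn leq_add //; last first.
  by apply: leq_sum => B _; apply: term.
rewrite !inE swK sw_i sw_j AH jA (negbTE iA) (negbTE sAH) /= add0n addn0.
exact: weight_sw.
Qed.

End Compression.

(** Among the families satisfying the required bounds, take one of least total weight: a missing
    shift would allow a compression that lowers it. *)
Theorem exists_shifted n k (H : {set {set 'I_n}}) : 0 < k -> uniform k H ->
  exists H' : {set {set 'I_n}}, [/\ uniform k H', shifted_from 0 H', #|H'| = #|H|,
    #|shadow k H'| <= #|shadow k H| & matching_number H' <= matching_number H].
Proof.
move=> k0 uH.
pose P (H' : {set {set 'I_n}}) := [&& [forall A in H', #|A| == k], #|H'| == #|H|,
  #|shadow k H'| <= #|shadow k H| & matching_number H' <= matching_number H].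
have PH : P H by rewrite /P !leqnn eqxx !andbT; apply/forall_inP => A /uH ->.
case: (@arg_minnP _ H P (fun H' => \sum_(B in H') weight B) PH) => H'.
case/and4P=> /forall_inP uH'b /eqP cH' sH' mH' minH'.
have uH' : uniform k H' by move=> A /uH'b/eqP.
exists H'; split=> // A i j AH' _ ij jA iA; rewrite -sw_swap //; apply/negP => /negP nH.
have := weight_compress ij AH' jA iA nH; rewrite ltnNge => /negP; apply; apply: minH'.
apply/and4P; split.
- by apply/forall_inP => B /(compress_uniform uH') ->.
- by rewrite card_compress cH'.
- apply: leq_trans sH'; rewrite -(card_compress i j (shadow k H')).
  exact/subset_leq_card/shadow_compress.
- exact: leq_trans (matching_compress i j H') mH'.
Qed.

(** * Shifted families with bounded matching number *)

(** Such a set is the union of a j-subset Y of X and a (k-j)-set, namely the rest of A. *)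
Lemma card_meeting n k j (X : {set 'I_n}) :
  #|[set A : {set 'I_n} | (#|A| == k) && (j <= #|A :&: X|)]| <= 'C(#|X|, j) * 'C(n, k - j).
Proof.
rewrite -cards_draws -[n in 'C(n, _)]card_ord -card_draws -cardsX.
apply: leq_trans (leq_imset_card (fun YZ => YZ.1 :|: YZ.2) _).
apply/subset_leq_card/subsetP => A; rewrite inE => /andP[/eqP cA jAX].
have /card_gt0P[Y] : 0 < #|[set Y : {set 'I_n} | Y \subset A :&: X & #|Y| == j]|.
  by rewrite cards_draws bin_gt0.
rewrite inE subsetI => /andP[/andP[YA YX] cY].
apply/imsetP; exists (Y, A :\: Y); last first.
  by rewrite /= setUC setDE setUIl [~: Y :|: _]setUC setUCr setIT; apply/esym/setUidPl.
by rewrite !inE /= YX cY cardsD (setIidPr YA) (eqP cY) cA eqxx.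
Qed.

Section Intervals.
Variable n : nat.
Implicit Types (A B : {set 'I_n}) (H : {set {set 'I_n}}) (v : nat).

Definition seg a b : {set 'I_n} := [set i : 'I_n | a <= i < b].
Definition ini v : {set 'I_n} := [set i : 'I_n | i < v].

Lemma card_seg a b : b <= n -> #|seg a b| = b - a.
Proof.
move=> bn; rewrite -sum1dep_card -(big_ord_widen_cond _ (fun i => a <= i) (fun=> 1) bn).
rewrite -(big_mkord (fun i => a <= i) (fun=> 1)).
have [ab|ba] := leqP a b; last first.
  rewrite big_nat_cond big1 => [|i /andP[/andP[_ ib] ai]]; last by lia.
  by lia.
rewrite (@big_cat_nat _ _ _ a) //= big_nat_cond big1 ?add0n => [|i]; last by lia.
rewrite big_nat_cond (eq_bigl (fun i => a <= i < b)) => [|i]; last by lia.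
by rewrite -big_nat sum_nat_const_nat muln1.
Qed.

Lemma card_ini v : #|ini v| <= v.
Proof.
have [vn|nv] := leqP v n; last by rewrite (leq_trans (max_card _)) // card_ord ltnW.
by rewrite -[v in _ <= v]subn0 -card_seg // subset_leq_card //; apply/subsetP => i; rewrite !inE.
Qed.

Lemma ini_mono u v : u <= v -> ini u \subset ini v.
Proof. by move=> uv; apply/subsetP => i; rewrite !inE => /leq_trans; apply. Qed.

(** Move x, the least point of A outside B, to y, the least point of B outside A. Domination forces
    y < x and survives the move: only the counts for y < v <= x grow, and there the new set lies
    inside B. Repeat until A = B. *)
Lemma shifted_dominated H A B : shifted_from 0 H -> A \in H -> #|A| = #|B| ->
  (forall v, #|A :&: ini v| <= #|B :&: ini v|) -> B \in H.
Proof.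
move=> sH; have [d] := ubnP #|A :\: B|; elim: d A => // d IHd A dA AH cAB dom.
have [<- //|AB] := eqVneq A B.
have nsub (C D : {set 'I_n}) : #|C| = #|D| -> C != D -> exists x, x \in C :\: D.
  move=> cCD CD; apply/set0Pn; rewrite setD_eq0; apply: contra CD => CD.
  by rewrite eqEcard CD cCD leqnn.
have [x0 x0P] := nsub _ _ cAB AB.
have BA : B != A by rewrite eq_sym.
have [y0 y0P] := nsub _ _ (esym cAB) BA.
case: (@arg_minnP _ x0 (mem (A :\: B)) val x0P) => x /setDP[xA xB] xmin.
case: (@arg_minnP _ y0 (mem (B :\: A)) val y0P) => y /setDP[yB yA] ymin.
have yx : y < x.
  rewrite ltnNge leq_eqVlt; apply/negP => /orP[/eqP/val_inj e|xy].
    by rewrite e yB in xB.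
  have := dom x.+1; rewrite leqNgt => /negP; apply; apply/proper_card/properP; split.
    apply/subsetP => z; rewrite !inE => /andP[zB zx]; rewrite zx andbT.
    apply: contraLR zx => zA; rewrite -ltnNge ltnS.
    by apply: leq_trans xy (ymin z _); apply/setDP.
  by exists x; rewrite !inE ?ltnSn ?xA // (negbTE xB).
apply: (IHd (y |: A :\ x)).
- rewrite ltnS in dA; apply: leq_trans dA; apply/proper_card/properP; split.
    apply/subsetP => z; rewrite !inE => /andP[zB /orP[/eqP e|/andP[_ ->]]].
      by rewrite e yB in zB.
    by rewrite zB.
  by exists x; rewrite !inE ?eqxx ?xA ?xB ?andbF //= orbF; rewrite neq_ltn yx orbT.
- exact: sH.
- by rewrite card_swap.
move=> v; have [vy|yv] := leqP v y.
  apply: leq_trans (dom v); apply/subset_leq_card/subsetP => z; rewrite !inE.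
  by case/andP=> /orP[/eqP->|/andP[_ ->] ->//]; rewrite ltnNge vy.
have [vx|xv] := leqP v x.
  apply/subset_leq_card/subsetP => z; rewrite !inE.
  case/andP=> /orP[/eqP->|/andP[_ zA] zv]; rewrite ?yB // zv andbT.
  apply: contraLR zv => zB; rewrite -leqNgt (leq_trans vx) //.
  by apply: xmin; apply/setDP.
apply: leq_trans (dom v); rewrite leq_eqVlt; apply/orP; left; apply/eqP.
rewrite -(@card_swap _ (A :&: ini v) y x) ?inE ?xA // ?(negbTE yA) //.
apply: eq_card => z; rewrite !inE; case: (eqVneq z y) => [->|_] /=; first by rewrite yv.
by rewrite andbA.
Qed.

Lemma matching_free H r (f : 'I_r.+1 -> {set 'I_n}) :
  (forall t, f t != set0) -> (forall t t' z, z \in f t -> z \in f t' -> t = t') ->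
  matching_number H <= r -> exists t, f t \notin H.
Proof.
move=> f0 fdisj; rewrite leqNgt => /negP mH; apply/existsP; rewrite -negb_forall.
apply/negP => /forallP fH; apply: mH.
have finj : injective f.
  by move=> t t' e; have /set0Pn[z zf] := f0 t; apply: (fdisj t t' z); rewrite -?e.
rewrite -[r.+1]card_ord -(card_imset _ finj) /matching_number.
apply: (@leq_bigmax_cond _ _ (fun M : {set {set 'I_n}} => #|M|)).
apply/andP; split.
  by rewrite powersetE; apply/subsetP => _ /imsetP[t _ ->]; apply: fH.
apply/forall_inP => _ /imsetP[t _ ->]; apply/forall_inP => _ /imsetP[t' _ ->].
apply/implyP => ff; apply/pred0P => z /=; apply/negP => /andP[zt zt'].
by rewrite (fdisj _ _ _ zt zt') eqxx in ff.
Qed.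

End Intervals.

Lemma block_inj w y t t' :
  t * w <= y < t * w + w -> t' * w <= y < t' * w + w -> t = t'.
Proof. by case: (ltngtP t t') => // tt'; nia. Qed.

Lemma cardsU_disjoint (T : finType) (A B : {set T}) :
  A :&: B = set0 -> #|A :|: B| = #|A| + #|B|.
Proof. by move=> e; rewrite cardsU e cards0 subn0. Qed.

Section Structure.
Variables (n k s : nat) (H : {set {set 'I_n}}).
Hypotheses (uH : uniform k H) (sH : shifted_from 0 H) (mH : matching_number H <= s).
Implicit Types A B : {set 'I_n}.

(* Otherwise H would contain the s+1 disjoint sets consisting of {t, 2s+1-t} and
   a block of k-2 further points. *)
Lemma pair_dichotomy (T := 2 * s + 2 + s.+1 * (k - 2)) : 1 < k -> T <= n ->
  exists2 t, t <= s & forall A, A \in H -> A :&: ini n t = set0 ->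
    1 < #|A :&: ini n (2 * s + 1 - t)| \/ 2 < #|A :&: ini n T|.
Proof.
move=> k1 Tn; pose w := k - 2; pose u t := 2 * s + 1 - t; pose c t := 2 * s + 2 + t * w.
pose f (t : 'I_s.+1) := seg n t t.+1 :|: seg n (u t) (u t).+1 :|: seg n (c t) (c t + w).
have cT (t : 'I_s.+1) : c t + w <= T.
  by have : t.+1 * w <= s.+1 * w by [rewrite leq_mul2r ltn_ord orbT]; rewrite /c /T -/w; lia.
have T_ge : 2 * s + 2 <= T by rewrite leq_addr.
have ts (t : 'I_s.+1) : t <= s by rewrite -ltnS.
have cardf (t : 'I_s.+1) : #|f t| = k.
  have t1 := ts t; rewrite !cardsU_disjoint; last first.
  - by apply/setP => z; rewrite !inE /u /c; have := leq0n (t * w); lia.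
  - by apply/setP => z; rewrite !inE /u; lia.
  rewrite !card_seg //; [by rewrite /w; lia | exact: leq_trans (cT t) Tn | |].
  - by rewrite /u; lia.
  - by have := ltn_ord t; lia.
have [t||//|t tH] := @matching_free n H s f.
- by rewrite -card_gt0 cardf; lia.
- move=> t t' z; have t1 := ts t; have t1' := ts t'.
  rewrite !inE /u /c => h h'; apply/val_inj => /=.
  have p := leq0n (t * w); have p' := leq0n (t' * w).
  case: (ltnP z (2 * s + 2)) => zs; first by lia.
  by apply: (@block_inj w (z - (2 * s + 2))); lia.
exists t => // A AH At.
case: (ltnP 1 #|A :&: ini n (2 * s + 1 - t)|) => [|A1]; first by left.
case: (ltnP 2 #|A :&: ini n T|) => [|A2]; first by right.
case/negP: tH; apply: (shifted_dominated sH AH); first by rewrite cardf (uH AH).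
have t1 := ts t; have tn : t < n by lia.
have un : u t < n by rewrite /u; lia.
have tf : Ordinal tn \in f t by rewrite !inE /= leqnn ltnSn.
have uf : Ordinal un \in f t by rewrite !inE /= leqnn ltnSn orbT.
(* On the ranges of v cut by t, [u t] and T, the set [f t] has at least 0, 1, 2, k points below v,
   and A has at most that many. *)
move=> v; case: (leqP v t) => [vt|tv].
  by rewrite (_ : A :&: ini n v = set0) ?cards0 //; apply/eqP; rewrite -subset0 -At setIS // ini_mono.
case: (leqP v (u t)) => [vu|uv].
  apply: (@leq_trans 1).
    by apply: leq_trans A1; apply/subset_leq_card/setIS/ini_mono.
  by apply/card_gt0P; exists (Ordinal tn); rewrite inE tf inE.
case: (leqP v T) => [vT|Tv].
  apply: (@leq_trans 2).
    by apply: leq_trans A2; apply/subset_leq_card/setIS/ini_mono.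
  have <- : #|[set Ordinal tn; Ordinal un]| = 2.
    by rewrite cards2 -val_eqE /= /u; case: eqP; lia.
  apply/subset_leq_card/subsetP => z; rewrite !in_set2 => /orP[/eqP->|/eqP->].
    by rewrite inE tf inE.
  by rewrite inE uf inE.
apply: (@leq_trans #|f t|); first by rewrite cardf -(uH AH) subset_leq_card // subsetIl.
apply/subset_leq_card/subsetP => z zf; rewrite inE zf inE (leq_trans _ (ltnW Tv)) //.
move: zf; rewrite !inE => zf; have := cT t.
by move: zf; rewrite /u; lia.
Qed.

(* Otherwise H would contain {s, ..., s+k-1}, and the s sets consisting of
   a point t < s and a block of k-1 further points. *)
Lemma star_dichotomy (T := s + k + s * (k - 1)) B : 0 < k -> 0 < s -> T <= n ->
  B \in H -> B :&: ini n s = set0 ->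
  forall A, A \in H -> A :&: ini n s.-1 = set0 -> 1 < #|A :&: ini n T|.
Proof.
move=> k0 s0 Tn BH Bs; pose w := k - 1; pose c t := s + k + t * w.
pose g t := seg n t t.+1 :|: seg n (c t) (c t + w).
pose f (t : 'I_s.+1) := if t < s then g t else seg n s (s + k).
have T_ge : s + k <= T by rewrite leq_addr.
have cT t : t < s -> c t + w <= T.
  by move=> ts; have : t.+1 * w <= s * w by [rewrite leq_mul2r ts orbT]; rewrite /c /T -/w; lia.
have cardg t : t < s -> #|g t| = k.
  move=> ts; rewrite cardsU_disjoint; last first.
    by apply/setP => z; rewrite !inE /c; have := leq0n (t * w); lia.
  rewrite !card_seg //; [by rewrite /w; lia | exact: leq_trans (cT t ts) Tn | lia].
have [t||//|t tH] := @matching_free n H s f.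
- rewrite -card_gt0 /f; case: ifP => [/cardg -> //|_].
  by rewrite card_seg; lia.
- move=> t t' z; have t1 := ltn_ord t; have t1' := ltn_ord t'.
  move=> h h'; apply/val_inj; move: h h'; rewrite /f /=.
  case: ifP => ts; case: ifP => ts'; rewrite !inE /c;
    have p := leq0n (t * w); have p' := leq0n (t' * w); try lia.
  case: (ltnP z s) => zs; first by lia.
  by move=> h h'; apply: (@block_inj w (z - (s + k))); lia.
(* As B has no point below s, it shifts down to {s, ..., s+k-1}, which is therefore in H; the
   missing set must be some [g t] with t < s. *)
move: tH; rewrite /f; case: ifP => [ts tH|ts /negP[]]; last first.
  apply: (shifted_dominated sH BH); first by rewrite (uH BH) card_seg ?addKn //; lia.
  move=> v; case: (leqP v s) => [vs|sv].
    by rewrite (_ : B :&: ini n v = set0) ?cards0 //; apply/eqP; rewrite -subset0 -Bs setIS // ini_mono.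
  have [vk|kv] := leqP v (s + k).
    have -> : seg n s (s + k) :&: ini n v = seg n s v by apply/setP => z; rewrite !inE; lia.
    apply/subset_leq_card/subsetP => z; rewrite !inE => /andP[zB ->]; rewrite andbT leqNgt.
    by apply/negP => zs; have := in_set0 z; rewrite -Bs !inE zB zs.
  have -> : seg n s (s + k) :&: ini n v = seg n s (s + k) by apply/setP => z; rewrite !inE; lia.
  by rewrite card_seg; [rewrite addKn -(uH BH) subset_leq_card // subsetIl | lia].
move=> A AH As; rewrite ltnNge; apply/negP => A1; case/negP: tH.
have tn : t < n by lia.
have tg : Ordinal tn \in g t by rewrite !inE /= leqnn ltnSn.
apply: (shifted_dominated sH AH); first by rewrite cardg ?(uH AH).
move=> v; case: (leqP v t) => [vt|tv].
  rewrite (_ : A :&: ini n v = set0) ?cards0 //; apply/eqP.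
  by rewrite -subset0 -As setIS // ini_mono //; lia.
case: (leqP v T) => [vT|Tv].
  apply: (@leq_trans 1).
    by apply: leq_trans A1; apply/subset_leq_card/setIS/ini_mono.
  by apply/card_gt0P; exists (Ordinal tn); rewrite inE tg inE.
apply: (@leq_trans #|g t|); first by rewrite cardg // -(uH AH) subset_leq_card // subsetIl.
apply/subset_leq_card/subsetP => z zg; rewrite inE zg inE (leq_trans _ (ltnW Tv)) //.
by move: zg; rewrite !inE; have := cT t ts; lia.
Qed.

End Structure.

(** * Members sorted by their least element, and the link of 0 *)

Section FirstElement.
Variables (n k : nat) (H : {set {set 'I_n}}) (x0 : 'I_n).
Hypotheses (uH : uniform k H) (sH : shifted_from 0 H) (x00 : x0 = 0 :> nat).
Implicit Types A B : {set 'I_n}.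

Definition hitting (G : {set {set 'I_n}}) t := [set A in G | A :&: ini n t != set0].
Definition starting (G : {set {set 'I_n}}) (x : 'I_n) :=
  [set A in G | (x \in A) && (A :&: ini n x == set0)].

Lemma hitting_succ (x : 'I_n) : #|hitting H x.+1| <= #|hitting H x| + #|starting H x|.
Proof.
apply: leq_trans (leq_card_setU _ _); apply/subset_leq_card/subsetP => A.
rewrite !inE => /andP[-> /set0Pn[z]] /=; rewrite !inE ltnS leq_eqVlt => /andP[zA zx].
case: (eqVneq (A :&: ini n x) set0) => //= Ax; case/orP: zx => [/eqP/val_inj <-|zx]; first by rewrite zA.
by move/setP: Ax => /(_ z); rewrite !inE zA zx.
Qed.

Lemma starting_min (x : 'I_n) A : A \in starting H x -> (x0 \in A) = (x == x0).
Proof.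
rewrite inE => /and3P[_ xA /eqP Ax]; case: eqVneq => [<- //|xx0].
apply/negP => x0A; have := in_set0 x0; rewrite -Ax !inE x0A x00 /=.
by move: xx0; rewrite -val_eqE /= x00 -lt0n => ->.
Qed.

Lemma starting_move (x : 'I_n) A : A \in starting H x -> x0 |: A :\ x \in H.
Proof.
move=> AS; have e := starting_min AS; move: AS; rewrite inE => /and3P[AH xA _].
case: (eqVneq x x0) e => [<- _|xx0 x0A]; first by rewrite setD1K.
apply: sH => //; last by rewrite x0A.
by move: xx0; rewrite -val_eqE /= x00 -lt0n.
Qed.

Lemma starting_notin (x : 'I_n) A : A \in starting H x -> x0 \notin A :\ x.
Proof. by move=> /starting_min e; rewrite !inE e eq_sym andNb. Qed.

(** Replacing the least element x by 0 stays in H, so deleting x maps these members injectively into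
    the link of 0. *)
Lemma starting_le (x : 'I_n) : #|starting H x| <= #|lnk x0 H|.
Proof.
rewrite -[#|starting H x|](@card_in_imset _ _ (fun A => A :\ x)) => [|A B]; last first.
  rewrite !inE => /and3P[_ xA _] /and3P[_ xB _] e.
  by rewrite -(setD1K xA) e setD1K.
apply/subset_leq_card/subsetP => _ /imsetP[A AS ->].
by rewrite inE starting_notin // starting_move.
Qed.

Lemma hitting_le t : t <= n -> #|hitting H t| <= t * #|lnk x0 H|.
Proof.
elim: t => [_|t IHt tn].
  rewrite leqn0 cards_eq0; apply/eqP/setP => A; rewrite !inE.
  apply/negP => /andP[_ /set0Pn[z]]; by rewrite !inE ltn0 andbF.
apply: leq_trans (hitting_succ (Ordinal tn)) _; rewrite mulSn addnC.
exact: leq_add (starting_le _) (IHt (ltnW tn)).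
Qed.

Lemma lnk_sub_del_shadow : lnk x0 H \subset del x0 (shadow k H).
Proof.
apply/subsetP => C; rewrite [C \in lnk _ _]inE => /andP[x0C CH].
rewrite inE x0C andbT -(setU1K x0C).
by apply: shadow_setD1; rewrite ?setU11.
Qed.

Lemma lnk_le_shadow : #|lnk x0 H| + #|lnk x0 (shadow k H)| <= #|shadow k H|.
Proof.
by rewrite [leqRHS](card_lnk_del x0) addnC leq_add2l subset_leq_card // lnk_sub_del_shadow.
Qed.

(* A |-> A \ {x, y}, with y < T a second element of A, sends sets starting at x to
   the link of 0 in the shadow, and is at most T-to-one. *)
Lemma starting_le_shadow T (x : 'I_n) :
  (forall A, A \in starting H x -> 1 < #|A :&: ini n T|) ->
  #|starting H x| <= T * #|lnk x0 (shadow k H)|.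
Proof.
move=> hT; rewrite mulnC.
apply: (@leq_trans #|setX (lnk x0 (shadow k H)) (ini n T)|); last first.
  by rewrite cardsX leq_mul2l card_ini orbT.
apply: leq_trans (leq_imset_card (fun Ey => x |: (Ey.2 |: Ey.1)) _).
apply/subset_leq_card/subsetP => A AS.
have xA : x \in A by move: AS; rewrite inE => /and3P[].
have /card_gt0P[y] : 0 < #|(A :&: ini n T) :\ x|.
  have := hT _ AS; rewrite (cardsD1 x (A :&: ini n T)).
  by case: (_ \in _); rewrite ?add1n ?add0n //; apply: ltnW.
rewrite !inE => /and3P[yx yA yT].
apply/imsetP; exists ((A :\ x) :\ y, y) => /=; last first.
  by rewrite setD1K ?inE ?yx ?yA // setD1K.
rewrite in_setX inE [y \in _]inE yT andbT; have x0A := starting_notin AS.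
have -> : x0 \notin A :\ x :\ y by apply: contra x0A; apply/subsetP/subD1set.
have yx0 : y != x0 by apply: contraNneq x0A => <-; rewrite !inE yx.
have -> : x0 |: (A :\ x) :\ y = (x0 |: A :\ x) :\ y.
  by apply/setP => z; rewrite !inE; case: (eqVneq z x0) => [->|//]; rewrite eq_sym yx0.
apply: shadow_setD1 => //; first exact: starting_move.
by rewrite !inE yx yA orbT.
Qed.

End FirstElement.

(** * Counting and the dichotomy for shifted families *)

Lemma bin_dominates j K : exists N, forall n, N <= n -> K * 'C(n, j) <= 'C(n, j.+1).
Proof.
exists (j + j.+1 * K) => n nN; rewrite -(@leq_pmul2l j.+1) // mul_bin_left mulnA.
by rewrite leq_mul2r; apply/orP; right; lia.
Qed.

(** Bounds the k-sets with three points below the T of [pair_dichotomy]. Being O(n^(k-3)), it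
    becomes the o(1) part of m(n,k,s). *)
Definition err n k s := 'C(2 * s + 2 + s.+1 * (k - 2), 3) * 'C(n, k - 3).

(** A member missing {0, ..., t-1} has three points below T or two in the interval X = [t, 2s+1-t).
    With r = s-t, X has 2r+1 points, hence r(2r+1) pairs. *)
Lemma structure_count n k s (H : {set {set 'I_n}}) : 2 < k ->
  2 * s + 2 + s.+1 * (k - 2) <= n ->
  uniform k H -> shifted_from 0 H -> matching_number H <= s ->
  exists2 t, t <= s & #|H| <= #|hitting H t|
     + (s - t) * (2 * (s - t) + 1) * 'C(n, k - 2) + err n k s.
Proof.
move=> k2 Tn uH sH mH.
have [t ts ht] := pair_dichotomy uH sH mH (ltnW k2) Tn.
exists t => //; set T := 2 * s + 2 + _ in Tn ht.
pose X := seg n t (2 * s + 1 - t).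
have cX : #|X| = (2 * (s - t)).+1.
  have := leq_trans (leq_addr _ _ : 2 * s + 2 <= T) Tn.
  by move=> sn; rewrite card_seg; lia.
have -> : (s - t) * (2 * (s - t) + 1) = 'C(#|X|, 2).
  by rewrite cX bin2odd /= ?mul2n ?odd_double // doubleK addn1 mulnC.
apply: (@leq_trans (#|hitting H t| + #|[set A : {set 'I_n} | (#|A| == k) && (2 <= #|A :&: X|)]|
  + #|[set A : {set 'I_n} | (#|A| == k) && (3 <= #|A :&: ini n T|)]|)); last first.
  rewrite leq_add //; first by rewrite leq_add2l card_meeting.
  apply: leq_trans (card_meeting _ _ _) _; rewrite /err leq_mul2r leq_bin2l ?orbT //.
  exact: card_ini.
rewrite -addnA; apply: leq_trans (leq_add (leqnn _) (leq_card_setU _ _)).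
apply: leq_trans (leq_card_setU _ _); apply/subset_leq_card/subsetP => A AH.
rewrite !inE AH (uH _ AH) eqxx /=; have [At|//] := eqVneq.
case: (ht A AH At) => [h|->]; last by rewrite !orbT.
have <- : A :&: ini n (2 * s + 1 - t) = A :&: X; last by rewrite h.
apply/setP => z; rewrite !inE; case zA: (z \in A) => //=.
have := in_set0 z; rewrite -At !inE zA /=; case: ltnP => //= -> _.
Qed.

Lemma hitting_all n k s (H : {set {set 'I_n}}) : uniform k H ->
  (forall A, A \in H -> A :&: ini n s != set0) -> H \subset EMfrom n 0 k s.
Proof.
move=> uH hH; apply/subsetP => A AH; apply/EMfromP; split; first exact: uH.
  by have /set0Pn[i] := hH _ AH; rewrite !inE => /andP[iA si]; exists i.
exact/aboveP.
Qed.

Lemma weaken_ratio q q' m b : q <= q' -> q.+1 * m <= q * b -> q'.+1 * m <= q' * b.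
Proof. by move=> qq' h; nia. Qed.

Lemma cover_arith t r : 0 < t -> 0 < r ->
  t * (2 * (t + r) + 2) + r * (2 * r + 1) + 1 <= (t + r) * (2 * (t + r) + 1).
Proof.
move=> t0 r0; have tr : t <= t * r by rewrite leq_pmulr.
have -> : (t + r) * (2 * (t + r) + 1) = t * (2 * (t + r)) + t + 2 * (t * r) + r * (2 * r + 1).
  by ring.
by rewrite mulnDr; lia.
Qed.

(** Adding T times the last bound on m to the first gives (T+1)m <= K(d0+e) + (T+1)W. After
    multiplication by 2s the left side is (2K+2)m, since s(T+1) = K+1, and the error term costs at
    most one m. *)
Lemma star_arith s T m d0 e W sh : 0 < s ->
  m <= s.-1 * d0 + T * e + W -> 2 * s * T.+1 * W <= m -> d0 + e <= sh ->
  m <= s * d0 + W -> (2 * (s.-1 + T * s)).+1 * m <= 2 * (s.-1 + T * s) * (s * sh).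
Proof.
move=> s0 m1 Wm dsh m2; set K := s.-1 + T * s.
have TK : T <= K by apply: leq_trans (leq_addl _ _); rewrite leq_pmulr.
have h : T.+1 * m <= K * sh + T.+1 * W.
  apply: (@leq_trans (K * (d0 + e) + T.+1 * W)); last by rewrite leq_add2r leq_mul2l dsh orbT.
  have h1 := leq_mul (leqnn T) m2; have h2 := leq_mul TK (leqnn e).
  rewrite mulSn; apply: leq_trans (leq_add m1 h1) _.
  have -> : T * (s * d0 + W) = T * (s * d0) + T * W by rewrite mulnDr.
  have -> : K * (d0 + e) = s.-1 * d0 + T * (s * d0) + K * e by rewrite /K; ring.
  by rewrite mulSn; lia.
have h3 := leq_mul (leqnn (2 * s)) h.
have h4 : 2 * s * (T.+1 * m) = 2 * K * m + 2 * m.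
  rewrite /K -(prednK s0) /=; ring.
have h5 : 2 * s * (K * sh + T.+1 * W) = 2 * K * (s * sh) + 2 * s * T.+1 * W by ring.
by rewrite h4 h5 in h3; rewrite mulSn; lia.
Qed.

Theorem shifted_structure k s : 2 < k -> 0 < s ->
  exists q N, 0 < q /\ forall n (H : {set {set 'I_n}}), N <= n ->
    uniform k H -> shifted_from 0 H -> matching_number H <= s ->
    s * (2 * s + 1) * 'C(n, k - 2) + err n k s < #|H| ->
    H \subset EMfrom n 0 k s \/ q.+1 * #|H| <= q * (s * #|shadow k H|).
Proof.
move=> k2 s0; pose T' := s + k + s * (k - 1).
(* Dominates 2s+1, the value obtained for 0 < t < s, and 2(s-1+T's), the value for t = s;
   [weaken_ratio] passes to this common q. *)
pose q := 2 * s * T'.+1 + 2 * s + 1.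
pose c3 := 'C(2 * s + 2 + s.+1 * (k - 2), 3).
(* For large n the error is so small against C(n, k-2), and hence against |H|, that both cases
   absorb it. *)
have [N hN] := bin_dominates (k - 3) (c3 * (s * (2 * s + 1) + 2 * s * T'.+1)).
exists q, (N + (2 * s + 2 + s.+1 * (k - 2)) + T').+1; split; first by rewrite /q; lia.
move=> n H nN uH sH mH; set C2 := 'C(n, k - 2); set W := err n k s; set m := #|H|.
move=> mlt.
have Wsmall : (s * (2 * s + 1) + 2 * s * T'.+1) * W <= C2.
  have := hN n; have -> : (k - 3).+1 = k - 2 by lia.
  move=> /(_ ltac:(lia)); rewrite /W /err -/c3 -/C2.
  by rewrite mulnA [_ * c3]mulnC.
have n0 : 0 < n by lia.
pose x0 : 'I_n := Ordinal n0; have x00 : x0 = 0 :> nat by [].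
have shadow_ge := lnk_le_shadow x0 uH.
set d0 := #|lnk x0 H| in shadow_ge; set e := #|lnk x0 _| in shadow_ge.
set sh := #|shadow k H| in shadow_ge *.
have C2m : s * (2 * s + 1) * C2 <= m by lia.
have s_pos : 0 < s * (2 * s + 1) by rewrite muln_gt0 s0 addn1.
have C2m' : C2 <= m by apply: leq_trans C2m; rewrite leq_pmull.
have Wm1 : s * (2 * s + 1) * W <= m.
  by apply: leq_trans C2m'; apply: leq_trans Wsmall; rewrite mulnDl leq_addr.
have Wm2 : 2 * s * T'.+1 * W <= m.
  by apply: leq_trans C2m'; apply: leq_trans Wsmall; rewrite mulnDl leq_addl.
have Tn : 2 * s + 2 + s.+1 * (k - 2) <= n by lia.
have [t ts mle] := structure_count k2 Tn uH sH mH.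
rewrite -/m -/C2 -/W in mle.
have hit_t : #|hitting H t| <= t * d0 by apply: hitting_le => //; lia.
have [tlt|tge] := ltnP t s.
  right; have [r sr r0] : exists2 r, s = t + r & 0 < r by exists (s - t); lia.
  have r_eq : s - t = r by lia.
  rewrite r_eq in mle.
  case: (posnP t) => [t0|tpos].
    exfalso; move: mle; rewrite leqNgt => /negP; apply.
    apply: leq_ltn_trans mlt; rewrite t0 mul0n leqn0 in hit_t.
    by rewrite t0 (eqP hit_t) add0n leq_add2r sr t0 add0n.
  apply: (@weaken_ratio (2 * s + 1)); first by rewrite /q; lia.
  suff le : (2 * s + 2) * m <= s * (2 * s + 1) * d0.
    have : s * (2 * s + 1) * d0 <= s * (2 * s + 1) * sh by rewrite leq_mul2l; lia.
    by rewrite addn1 in le *; lia.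
  rewrite -(leq_pmul2l tpos).
  (* As P * C2 <= m and P * W <= m, multiplying the count by P turns its error terms into multiples
     of m; [cover_arith] then leaves t(2s+2)m <= tP d0. *)
  set P := s * (2 * s + 1) in Wm1 C2m s_pos mlt *.
  have mle' : m <= t * d0 + r * (2 * r + 1) * C2 + W by lia.
  have step : P * m <= t * (P * d0) + r * (2 * r + 1) * m + m.
    have l1 : P * m <= P * (t * d0 + r * (2 * r + 1) * C2 + W) by rewrite leq_mul2l mle' orbT.
    have l2 : r * (2 * r + 1) * (P * C2) <= r * (2 * r + 1) * m by rewrite leq_mul2l C2m orbT.
    apply: leq_trans l1 _; rewrite 2!(mulnDr P).
    apply: leq_add => //; apply: leq_add; first by rewrite mulnCA.
    by rewrite mulnCA.
  have Pge : t * (2 * s + 2) + r * (2 * r + 1) + 1 <= P by rewrite /P sr; apply: cover_arith.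
  have l3 := leq_mul Pge (leqnn m); rewrite 2!(mulnDl _ _ m) mul1n in l3.
  have : t * (2 * s + 2) * m + (r * (2 * r + 1) * m + m) <= t * (P * d0) + (r * (2 * r + 1) * m + m).
    by rewrite !addnA -mulnDl in l3 step *; apply: leq_trans l3 step.
  by rewrite leq_add2r -[t * _ * m]mulnA.
have ts_eq : t = s by lia.
have m_hit : m <= #|hitting H s| + W by move: mle; rewrite ts_eq subnn !mul0n addn0.
have [hall|] := boolP [forall A in H, A :&: ini n s != set0].
  by left; apply: hitting_all => // A AH; apply: (forall_inP hall).
rewrite negb_forall => /existsP[B]; rewrite negb_imply negbK => /andP[BH /eqP Bs].
right; have sn : s.-1 < n by rewrite /T' in nN; lia.
pose x := Ordinal sn.
have T'n : T' <= n by lia.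
have st := star_dichotomy uH sH mH (ltnW (ltnW k2)) s0 T'n BH Bs.
have start_e : #|starting H x| <= T' * e.
  apply: starting_le_shadow => // A; rewrite inE => /and3P[AH _ /eqP Ax].
  exact: st.
have start_d : #|starting H x| <= d0 by apply: starting_le.
have hit_s : #|hitting H s| <= s.-1 * d0 + #|starting H x|.
  rewrite -[in hitting H s](prednK s0); apply: leq_trans (hitting_succ H x) _.
  by rewrite leq_add2r; apply: hitting_le => //; apply: ltnW.
apply: (@weaken_ratio (2 * (s.-1 + T' * s))).
  by rewrite /q; lia.
apply: (@star_arith _ _ _ d0 e W) => //; last first.
  by rewrite ts_eq in hit_t; rewrite (leq_trans m_hit) // leq_add2r.
  by rewrite (leq_trans m_hit) // leq_add2r (leq_trans hit_s) // leq_add2l.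
Qed.

(** * Binomial coefficients of real numbers *)

Section Binomr.
Local Open Scope ring_scope.
Variable R : realType.
Implicit Types x y d : R.

Lemma binomr0 x : binomr x 0 = 1.
Proof. by rewrite /binomr big_ord0 fact0 divr1. Qed.

Lemma binomr_pascal x b : binomr x b.+1 = binomr (x - 1) b.+1 + binomr (x - 1) b.
Proof.
have fb : b`!%:R != 0 :> R by rewrite pnatr_eq0 -lt0n fact_gt0.
have sb : b%:R + 1 != 0 :> R by rewrite natr1 pnatr_eq0.
rewrite /binomr big_ord_recl big_ord_recr /= factS natrM.
rewrite (eq_bigr (fun i : 'I_b => x - 1 - i%:R)) => [|i _]; last first.
  by rewrite /bump /= add1n -natr1; ring.
set P := \prod_(i < b) _; rewrite -natr1 subr0; field.
by rewrite fb sb.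
Qed.

Lemma binomr_nat n b : binomr n%:R b = 'C(n, b)%:R :> R.
Proof.
elim: n b => [|n IHn] [|b]; rewrite ?binomr0 ?bin0 //.
  by rewrite bin0n /binomr big_ord_recl subr0 !mul0r.
by rewrite binomr_pascal -natr1 addrK !IHn binS natrD.
Qed.

Lemma binomr_ge0 x b : b%:R - 1 <= x -> 0 <= binomr x b.
Proof.
move=> bx; rewrite /binomr divr_ge0 ?ler0n // prodr_ge0 // => i _.
have : (i.+1%:R <= b%:R :> R) by rewrite ler_nat.
by rewrite -natr1; lra.
Qed.

Lemma ler_binomr x y b : b%:R - 1 <= x -> x <= y -> binomr x b <= binomr y b.
Proof.
move=> bx xy; rewrite /binomr ler_wpM2r ?invr_ge0 ?ler0n //.
apply: ler_prod => i _.
have : (i.+1%:R <= b%:R :> R) by rewrite ler_nat.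
by rewrite -natr1; lra.
Qed.

Lemma binomr_diff x b r :
  binomr x b.+1 - binomr (x - r%:R) b.+1 = \sum_(i < r) binomr (x - i.+1%:R) b.
Proof.
elim: r => [|r IHr]; first by rewrite big_ord0 subr0 subrr.
rewrite big_ord_recr /= -IHr -natr1 opprD addrA (binomr_pascal (x - r%:R)).
by ring.
Qed.

Lemma binomr_diff_ge x b r : b%:R - 1 <= x - r%:R ->
  r%:R * binomr (x - r%:R) b <= binomr x b.+1 - binomr (x - r%:R) b.+1.
Proof.
move=> bx; rewrite binomr_diff mulr_natl -[r in _ *+ r]card_ord -sumr_const.
apply: ler_sum => i _; apply: ler_binomr => //.
by rewrite lerB // ler_nat.
Qed.

Lemma binomr_sign x b : x <= 0 -> 0 <= (-1) ^+ b * binomr x b.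
Proof.
move=> x0; rewrite /binomr mulrA -[b in (-1) ^+ b]card_ord -prodr_const -big_split /=.
rewrite divr_ge0 ?ler0n // prodr_ge0 // => i _.
by have := ler0n R i; lra.
Qed.

(** For x <= 0 the sign of [binomr x b] is that of (-1)^b. For odd b it is not positive; for even b,
    lowering x increases it, so each of the r telescoped terms is at least [binomr x b]. *)
Lemma binomr_neg x b r : x <= 0 -> 
  binomr x b <= 0 \/ r%:R * binomr x b <= binomr x b.+1 - binomr (x - r%:R) b.+1.
Proof.
move=> x0; case odd_b: (odd b).
  by left; have := binomr_sign b x0; rewrite -signr_odd odd_b expr1; lra.
right; rewrite binomr_diff mulr_natl -[r in _ *+ r]card_ord -sumr_const.
apply: ler_sum => i _; elim: (i.+1) => [|j IHj]; first by rewrite subr0.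
apply: (le_trans IHj); rewrite -natr1 opprD addrA.
case: b odd_b IHj => [|b] odd_b _; first by rewrite !binomr0.
rewrite (binomr_pascal (x - j%:R)) gerDl.
have := @binomr_sign (x - j%:R - 1) b; rewrite -signr_odd.
move: odd_b => /= /negbFE ->; rewrite expr1 => h.
by have := ler0n R j; lra.
Qed.

Lemma binomr_ratio b (c : R) d : 0 <= c -> 0 < d ->
  exists X, forall x, X <= x -> binomr x b <= (1 + d) * binomr (x - c) b.
Proof.
move=> c0; rewrite /binomr; suff prod_ratio : forall d, 0 < d -> exists X, forall x,
    X <= x -> 0 <= \prod_(i < b) (x - c - i%:R)
    /\ \prod_(i < b) (x - i%:R) <= (1 + d) * \prod_(i < b) (x - c - i%:R).
  move=> /prod_ratio[X hX]; exists X => x /hX[_ le].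
  by rewrite mulrA ler_wpM2r ?invr_ge0 ?ler0n.
elim: b => [|b IHb] {}d d0.
  by exists 0 => x _; rewrite !big_ord0; split; lra.
(* Chosen so that (1+e)^2 <= 1+d: one factor for the first b terms, one for the new term. *)
pose e := Num.min 1 d / 3.
have e0 : 0 < e by rewrite divr_gt0 // lt_min ltr01 d0.
have e1 : e <= 1 / 3 by rewrite ler_pM2r ?invr_gt0 // ge_min lexx.
have e2 : e <= d / 3 by rewrite ler_pM2r ?invr_gt0 // ge_min lexx orbT.
have [X hX] := IHb e e0; exists (Num.max X (c + b%:R + c / e)) => x.
rewrite ge_max => /andP[/hX[P0 PX] xc]; rewrite !big_ord_recr /=.
set P := \prod_(i < b) _ in PX *; set Q := \prod_(i < b) _ in P0 PX *.
have ce : 0 <= c / e by rewrite divr_ge0 // ltW.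
have cx : c <= e * (x - c - b%:R).
  have : c / e <= x - c - b%:R by lra.
  by rewrite ler_pdivrMr // mulrC.
split; first by apply: mulr_ge0 => //; lra.
have xb : 0 <= x - b%:R by have := ler0n R b; lra.
apply: (le_trans (ler_wpM2r xb PX)).
apply: (@le_trans _ _ ((1 + e) * Q * ((1 + e) * (x - c - b%:R)))).
  by apply: ler_wpM2l; [apply: mulr_ge0 => //; lra | lra].
rewrite mulrACA ler_wpM2r //; first by apply: mulr_ge0 => //; lra.
by nra.
Qed.

End Binomr.

(** * The Lovasz form of the shadow bound *)

Section Lovasz.
Local Open Scope ring_scope.
Variables (R : realType) (n : nat).
Implicit Types (x : R) (H : {set {set 'I_n}}).

Lemma above_lt_n p k H : (0 < k)%N -> uniform k H -> (forall A, A \in H -> above p A) ->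
  (0 < #|H|)%N -> (p < n)%N.
Proof.
move=> k0 uH aH /card_gt0P[A AH].
have /card_gt0P[i iA] : (0 < #|A|)%N by rewrite (uH _ AH).
exact: leq_ltn_trans (aboveP _ _ (aH _ AH) _ iA) (ltn_ord i).
Qed.

Theorem Lovasz_Kruskal_Katona p k H x : (0 < k)%N -> uniform k H ->
  (forall A, A \in H -> above p A) -> shifted_from p H -> k%:R <= x ->
  binomr x k <= #|H|%:R -> binomr x k.-1 <= #|shadow k H|%:R.
Proof.
have [d] := ubnP (n - p); elim: d p k H x => // d IHd p k H x dp k0 uH aH sH kx xH.
have Hpos : (0 < #|H|)%N.
  rewrite -(ltr_nat R); apply: lt_le_trans xH.
  apply: (@lt_le_trans _ _ (binomr k%:R k)); first by rewrite binomr_nat binn.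
  by apply: ler_binomr => //; lra.
have [k1|k1] := leqP k 1.
  have -> : k = 1%N by lia.
  by rewrite binomr0 ler1n shadow1_gt0.
have pn := above_lt_n k0 uH aH Hpos; pose y := Ordinal pn.
have k_pred : k = k.-1.+1 by lia.
have kR : k.-1%:R = k%:R - 1 :> R by rewrite [in RHS]k_pred -natr1 addrK.
have dn : (n - p.+1 < d)%N by lia.
have subH : (#|shadow k (del y H)| <= #|lnk y H|)%N.
  exact/subset_leq_card/shadow_del_lnk.
have IHdel z := IHd p.+1 k (del y H) z dn k0 (@del_uniform _ _ y _ uH)
  (fun A => @above_del _ y H A aH) (@del_shifted _ y _ sH).
have IHlnk := IHd p.+1 k.-1 (lnk y H) (x - 1) dn _ (@lnk_uniform _ _ y _ uH)
  (fun A => @above_lnk _ y H A aH) (@lnk_shifted _ y _ sH).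
have pascal := binomr_pascal x k.-1; rewrite -k_pred in pascal.
have split_card : #|H|%:R = #|lnk y H|%:R + #|del y H|%:R :> R.
  by rewrite (card_lnk_del y H) natrD.
have lnk_ge : binomr (x - 1) k.-1 <= #|lnk y H|%:R.
  rewrite leNgt; apply/negP => lt.
  have del_gt : binomr (x - 1) k < #|del y H|%:R by lra.
  suff : binomr (x - 1) k.-1 <= #|shadow k (del y H)|%:R.
    by rewrite leNgt (le_lt_trans _ lt) // ler_nat.
  have [xk|xk] := leP k%:R (x - 1); first by apply: IHdel => //; apply: ltW.
  (* When x - 1 < k the induction hypothesis is used at k instead: the deletion is nonempty, so it
     has at least C(k,k) members. *)
  apply: (@le_trans _ _ (binomr k%:R k.-1)).
    by apply: ler_binomr; rewrite ?kR; lra.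
  apply: IHdel => //; rewrite binomr_nat binn ler1n -(ltr_nat R).
  by apply: le_lt_trans del_gt; apply: binomr_ge0; lra.
have k1_pred : k.-1 = k.-1.-1.+1 by lia.
rewrite k1_pred binomr_pascal -k1_pred.
apply: (@le_trans _ _ (#|lnk y H|%:R + #|shadow k.-1 (lnk y H)|%:R)); last first.
  by rewrite -natrD ler_nat shadow_ge.
by apply: lerD lnk_ge (IHlnk _ _ lnk_ge); rewrite ?kR; [lia | lra].
Qed.

(** Induction on the number r of star points left. By Pascal the hypothesis splits into
    [binomr (x - 1) k.-1] for the link, which has no star condition and falls under
    [Lovasz_Kruskal_Katona], and the same difference at x-1, r-1 for the deletion. *)
Theorem Lovasz_EMfrom p r k H x : (1 < k)%N -> (p + r <= n)%N ->
  H \subset EMfrom n p k (p + r) -> shifted_from p H -> (0 < r)%N -> (k + r)%:R <= x ->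
  binomr x k - binomr (x - r%:R) k <= #|H|%:R -> binomr x k.-1 <= #|shadow k H|%:R.
Proof.
move=> k1; elim: r p H x => // r IHr p H x prn HE sH _ krx xH.
have pn : (p < n)%N by lia.
pose y := Ordinal pn.
have uH := EMfrom_uniform HE; have aH := EMfrom_above HE.
have k_pred : k = k.-1.+1 by lia.
have kR : k.-1%:R = k%:R - 1 :> R by rewrite [in RHS]k_pred -natr1 addrK.
have pascal := binomr_pascal x k.-1; rewrite -k_pred in pascal.
have subH : (#|shadow k (del y H)| <= #|lnk y H|)%N.
  by apply/subset_leq_card/shadow_del_lnk => //; lia.
have split_card : #|H|%:R = #|lnk y H|%:R + #|del y H|%:R :> R.
  by rewrite (card_lnk_del y H) natrD.
have delE : del y H \subset EMfrom n p.+1 k (p.+1 + r).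
  by have := del_EMfrom (x := y) HE; rewrite addnS -addSn.
rewrite natrD -natr1 in krx.
have r0 := ler0n R r.
have lnk_ge : binomr (x - 1) k.-1 <= #|lnk y H|%:R.
  have xr : x - r.+1%:R = x - 1 - r%:R by rewrite -natr1; ring.
  rewrite xr in xH; case: (posnP r) => [e|rpos].
    move: delE xH split_card; rewrite e addn0 EMfrom_eq0 // subset0 => /eqP->.
    by rewrite cards0 subr0; lra.
  rewrite leNgt; apply/negP => lt.
  suff : binomr (x - 1) k.-1 <= #|shadow k (del y H)|%:R.
    by rewrite leNgt (le_lt_trans _ lt) // ler_nat.
  apply: (IHr p.+1) => //; [lia | exact: (@del_shifted _ y) | rewrite natrD; lra | lra].
have k1_pred : k.-1 = k.-1.-1.+1 by lia.
rewrite k1_pred binomr_pascal -k1_pred.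
apply: (@le_trans _ _ (#|lnk y H|%:R + #|shadow k.-1 (lnk y H)|%:R)); last first.
  by rewrite -natrD ler_nat shadow_ge.
apply: (lerD lnk_ge); apply: (@Lovasz_Kruskal_Katona p.+1) lnk_ge.
- by lia.
- exact: lnk_uniform.
- by move=> A; apply: (@above_lnk _ y).
- exact: (@lnk_shifted _ y).
- by rewrite kR; lra.
Qed.

End Lovasz.

(** * Shadows of initial segments *)

Lemma EMfrom0 n k s : EMfrom n 0 k s = EM1 n k s.
Proof.
apply/setP => A; rewrite [A \in EMfrom _ _ _ _]inE andb_idr // => _.
exact/aboveP.
Qed.

(** Take y to be the largest point covered by I. The shadow consists of subsets of {0, ..., y}; and
    any set with one point below s and the others in [s, y) precedes the member containing y, so it
    is in I. *)
Lemma initial_bounds n k s (I : {set {set 'I_n}}) : 1 < k ->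
  initial_segment (EM1 n k s) I ->
  exists y, #|shadow k I| <= 'C(y.+1, k.-1) /\ s * 'C(y - s, k.-1) <= #|I|.
Proof.
rewrite -EMfrom0 => k1 initI; have k0 := ltnW k1.
have uI := EMfrom_uniform initI.1; have [/subsetP IE init] := initI.
case: (set_0Vmem I) => [->|[A0 A0I]].
  by exists 0; rewrite shadow0 cards0 sub0n bin0n (_ : k.-1 == 0 = false) ?muln0 //; lia.
have /card_gt0P[y0 y0A] : 0 < #|A0| by rewrite (uI _ A0I).
have y0P : y0 \in cover I by apply/bigcupP; exists A0.
case: (@arg_maxnP _ y0 (mem (cover I)) val y0P) => y /bigcupP[A AI yA] ymax.
exists y; split.
  apply: (@leq_trans 'C(#|ini n y.+1|, k.-1)); last by rewrite leq_bin2l // card_ini.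
  rewrite -cards_draws; apply/subset_leq_card/subsetP => C /shadowP[cC [B BI CB]].
  rewrite inE cC eqxx andbT; apply: subset_trans CB _; apply/subsetP => z zB.
  by rewrite inE ltnS; apply: ymax; apply/bigcupP; exists B.
have [ys|sy] := leqP y s.
  rewrite (_ : y - s = 0); last by lia.
  by rewrite bin0n (_ : k.-1 == 0 = false) ?muln0 //; lia.
have sn : s <= n by rewrite ltnW // (ltn_trans sy).
pose Q := [set C : {set 'I_n} | C \subset seg n s y & #|C| == k.-1].
have <- : #|setX (ini n s) Q| = s * 'C(y - s, k.-1).
  rewrite cardsX cards_draws card_seg; last exact: ltnW.
  have <- // : seg n 0 s = ini n s by apply/setP => z; rewrite !inE.
  by rewrite card_seg ?subn0.
have Qge C z : C \in Q -> z \in C -> s <= z < y.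
  by rewrite inE => /andP[/subsetP CS _] /CS; rewrite inE.
pose F (iC : 'I_n * {set 'I_n}) := iC.1 |: iC.2.
rewrite -[#|setX _ _|](@card_in_imset _ _ F); last first.
  move=> [i C] [j D]; rewrite /F !in_setX /= => /andP[iS CQ] /andP[jS DQ] e.
  rewrite inE in iS; rewrite inE in jS.
  have iC : i \notin C by apply/negP => /(Qge _ _ CQ); lia.
  have jD : j \notin D by apply/negP => /(Qge _ _ DQ); lia.
  have ij : i = j.
    have : i \in j |: D by rewrite -e setU11.
    by rewrite in_setU1 => /orP[/eqP //|/(Qge _ _ DQ)]; lia.
  by rewrite ij in iC e *; rewrite -(setU1K iC) e setU1K.
apply/subset_leq_card/subsetP => A' /imsetP[[i C]]; rewrite /F in_setX /= => /andP[iS CQ] ->.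
rewrite inE in iS; have iC : i \notin C by apply/negP => /(Qge _ _ CQ); lia.
have cC : #|C| = k.-1 by move: CQ; rewrite inE => /andP[_ /eqP].
have lty z : z \in i |: C -> z < y.
  by rewrite in_setU1 => /orP[/eqP ->|/(Qge _ _ CQ)]; lia.
apply: (init _ A AI).
  apply/EMfromP; split; [by rewrite cardsU1 iC cC; lia | by exists i; rewrite ?setU11 |].
  exact/aboveP.
apply/colex_ltP; exists y; split=> //; first by apply/negP => /lty; rewrite ltnn.
move=> z yz; case: (boolP (z \in A)) => [zA|_].
  by have : z <= y by [apply: ymax; apply/bigcupP; exists A]; lia.
by apply/negP => /lty; lia.
Qed.

Lemma bin_unbounded j K : exists N, forall n, N <= n -> K <= 'C(n, j.+1).
Proof.
have [N hN] := bin_dominates j K; exists (N + j) => n nN.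
apply: leq_trans (hN n _); last by lia.
by rewrite leq_pmulr // bin_gt0; lia.
Qed.

Lemma eventually_le_nat (R : realType) (x : R) :
  exists N, forall n, N <= n -> (x <= n%:R)%R.
Proof.
exists (Num.bound `|x|)%R => n xn; apply: le_trans (real_ler_norm (num_real x)) _.
apply: le_trans (ltW (archi_boundP (normr_ge0 x))) _.
by rewrite ler_nat.
Qed.

(** For large y the two bounds of [initial_bounds] differ by a factor of at most s^-1(1+1/q). For
    small y the shadow is bounded by a constant, and m >= C(n, k-2) exceeds what is needed. *)
Lemma initial_shadow_asymp (R : realType) k s q : 2 < k -> 0 < q ->
  exists N, forall n, N <= n -> forall I : {set {set 'I_n}},
    initial_segment (EM1 n k s) I -> forall m, #|I| <= m -> 'C(n, k - 2) <= m ->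
    q * (s * #|shadow k I|) <= q.+1 * m.
Proof.
move=> k2 q0.
have d0 : (0 < q%:R^-1 :> R)%R by rewrite invr_gt0 ltr0n.
have [X hX] := @binomr_ratio R k.-1 s.+1%:R%R _ (ler0n _ _) d0.
have [X0 hX0] := eventually_le_nat X; pose X' := X0 + s.
have ratio y : X' <= y -> q * 'C(y.+1, k.-1) <= q.+1 * 'C(y - s, k.-1).
  move=> yX; have : (X <= y.+1%:R)%R.
    by apply: hX0; rewrite /X' in yX; lia.
  move=> /hX; rewrite -natrB ?ltnS; last by rewrite /X' in yX; lia.
  rewrite !binomr_nat subSS -(ler_nat R) !natrM => h.
  have q0R : (0 < q%:R :> R)%R by rewrite ltr0n.
  rewrite -(ler_pM2l q0R) mulrA mulrDr mulr1 mulfV ?gt_eqF // in h.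
  by rewrite -natr1.
have [N hN] := bin_unbounded (k - 3) (q * (s * 'C(X', k.-1))).
exists N => n nN I initI m Im Cm.
have [y [shI cI]] := initial_bounds (ltnW k2) initI.
have [yX|Xy] := leqP X' y.
  apply: (@leq_trans (s * (q * 'C(y.+1, k.-1)))).
    by rewrite mulnCA leq_mul2l leq_mul2l shI !orbT.
  apply: (@leq_trans (s * (q.+1 * 'C(y - s, k.-1)))); first by rewrite leq_mul2l ratio ?orbT.
  by rewrite mulnCA leq_mul2l (leq_trans cI Im) orbT.
apply: (@leq_trans (q * (s * 'C(X', k.-1)))).
  rewrite leq_mul2l leq_mul2l; apply/orP; right; apply/orP; right.
  by apply: leq_trans shI _; apply: leq_bin2l.
apply: leq_trans (hN n nN) _; rewrite (_ : (k - 3).+1 = k - 2); last by lia.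
by apply: leq_trans Cm _; rewrite leq_pmull.
Qed.

(** Equality for s = 1 and for k = 3, where C(2s+1,2) = s(2s+1); for k >= 4, k*C(s+1,2) >=
    2s(s+1). *)
Lemma cks_ge k s : 2 < k -> 0 < s -> s * (2 * s + 1) <= cks k s.
Proof.
move=> k2 s0; rewrite /cks; case: eqP => [->//|_].
case: eqP => [_|k3].
  by rewrite addn1 bin2odd /= ?mul2n ?odd_double // doubleK mulnC.
have : (s + 1) * s = 2 * 'C(s + 1, 2).
  by rewrite -mul_bin_diag bin1 addn1 mulnC.
by move: 'C(s + 1, 2) => b sb; have : 4 * b <= k * b by [rewrite leq_mul2r; lia]; nia.
Qed.

(** * Bounds for real x and assembly of the theorem *)

Local Open Scope ring_scope.

Lemma binomr_bound (R : realType) b (X x : R) : 0 <= x -> x <= X ->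
  binomr x b <= (X + b%:R) ^+ b.
Proof.
move=> x0 xX; apply: le_trans (real_ler_norm (num_real _)) _.
rewrite /binomr normrM normfV normr_nat ler_pdivrMr ?ltr0n ?fact_gt0 //.
apply: (@le_trans _ _ ((X + b%:R) ^+ b)); last first.
  by rewrite ler_peMr ?exprn_ge0 ?ler1n ?fact_gt0 // addr_ge0 ?ler0n // (le_trans x0).
rewrite normr_prod -[b in _ ^+ b]card_ord -prodr_const; apply: ler_prod => i _.
rewrite normr_ge0 /=; apply: le_trans (ler_normB _ _) _.
by rewrite normr_nat ger0_norm // lerD // ler_nat ltnW.
Qed.

(* [sh] plays the role of the size of a shadow satisfying both the crude bound
   [m <= s * sh] and, for large x, the Lovasz bound. *)
Lemma real_shadow_bound (R : realType) k s (X : R) : (2 < k)%N -> (0 < s)%N ->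
  exists N, forall m sh : nat, (N <= m)%N -> (m <= s * sh)%N ->
  forall x : R, m%:R = binomr x k - binomr (x - s%:R) k ->
    (X <= x -> binomr x (k - 1) <= sh%:R) -> binomr x (k - 1) <= sh%:R.
Proof.
move=> k2 s0; have k_pred : k = (k - 1).+1 by lia.
have [N hN] := eventually_le_nat (s%:R * (X + (k - 1)%:R) ^+ (k - 1)).
exists N => m sh Nm msh x mx large.
have sR : 0 < s%:R :> R by rewrite ltr0n.
have mshR : m%:R <= s%:R * sh%:R :> R by rewrite -natrM ler_nat.
(* For x <= 0 the binomial is nonpositive, or s times it is at most m and hence at most s * sh. *)
have [x0|x0] := leP x 0.
  have [le0|] := binomr_neg (k - 1) s x0; first exact: le_trans le0 (ler0n _ _).
  by rewrite -k_pred -mx => le; rewrite -(ler_pM2l sR) (le_trans le).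
have [/large //|xX] := leP X x.
(* For 0 < x < X the binomial is below a constant, while s * sh >= m >= N. *)
rewrite -(ler_pM2l sR) (le_trans _ mshR) // (le_trans _ (hN _ Nm)) // ler_pM2l //.
by apply: binomr_bound; apply: ltW.
Qed.

(** Telescoping gives m >= s * binom(x-s, k-1), and for large x replacing x-s by x costs at most the
    factor 1+1/q that the hypothesis supplies. *)
Lemma real_shadow_asymp (R : realType) k s q : (2 < k)%N -> (0 < q)%N -> (0 < s)%N ->
  exists X, forall m sh : nat, (q.+1 * m <= q * (s * sh))%N ->
  forall x : R, m%:R = binomr x k - binomr (x - s%:R) k -> X <= x ->
    binomr x (k - 1) <= sh%:R.
Proof.
move=> k2 q0 s0; have k_pred : k = (k - 1).+1 by lia.
have q0R : 0 < q%:R :> R by rewrite ltr0n.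
have d0 : 0 < q%:R^-1 :> R by rewrite invr_gt0.
have sR : 0 < s%:R :> R by rewrite ltr0n.
have [X hX] := @binomr_ratio R (k - 1) s%:R _ (ler0n _ _) d0.
exists (Num.max X (k + s)%:R) => m sh msh x mx; rewrite ge_max => /andP[/hX le ksx].
have := @binomr_diff_ge R x (k - 1) s; rewrite -k_pred -mx => /(_ _) lem.
have {lem} lem : s%:R * binomr (x - s%:R) (k - 1) <= m%:R.
  by apply: lem; move: ksx; rewrite natrD natrB ?(ltnW (ltnW k2)) //; lra.
have mshR : q.+1%:R * m%:R <= q%:R * (s%:R * sh%:R) :> R by rewrite -!natrM ler_nat.
rewrite -(ler_pM2l sR) -(ler_pM2l q0R) (le_trans _ mshR) //.
apply: (@le_trans _ _ (q.+1%:R * (s%:R * binomr (x - s%:R) (k - 1)))); last first.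
  by rewrite ler_pM2l // ltr0n.
rewrite mulrCA [leRHS]mulrCA ler_pM2l //.
have -> : q.+1%:R = q%:R * (1 + q%:R^-1) :> R.
  by rewrite mulrDr mulr1 mulfV ?gt_eqF // natr1.
by rewrite -mulrA ler_pM2l.
Qed.

Unset Implicit Arguments. Set Strict Implicit. Set Printing Implicit Defensive.

Theorem theorem1p10 (R : realType) (k s : nat) :
  (3 <= k)%N -> (1 <= s)%N ->
  exists m : nat -> R,
    (* m(n) = (c(k,s) + o(1)) * binom(n, k-2) as n -> oo *)
    (forall eps : R, 0 < eps -> exists N : nat, forall n : nat, (N <= n)%N ->
       `| m n - (cks k s)%:R * ('C(n, k - 2))%:R | <= eps * ('C(n, k - 2))%:R)
    /\
    (exists N : nat, forall n : nat, (N <= n)%N ->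
       forall H : {set {set 'I_n}},
         (forall A, A \in H -> #|A| = k) ->
         (matching_number H <= s)%N ->
         m n < (#|H|)%:R ->
         (#|shadow k (Lcolex #|H| (EM1 n k s))| <= #|shadow k H|)%N
         /\
         (forall x : R,
            (#|H|)%:R = binomr x k - binomr (x - s%:R) k ->
            binomr x (k - 1) <= (#|shadow k H|)%:R)).
Proof.
move=> k2 s0; exists (fun n => (cks k s * 'C(n, k - 2) + err n k s)%:R); split.
  move=> eps eps0; have [K hK] := eventually_le_nat eps^-1.
  have [N hN] := bin_dominates (k - 3) (K.+1 * 'C(2 * s + 2 + s.+1 * (k - 2), 3)).
  exists N => n /hN; rewrite (_ : (k - 3).+1 = k - 2)%N; last by lia.
  rewrite -mulnA -/(err n k s) => le; rewrite natrD natrM addrAC subrr add0r normr_nat.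
  have leR : K.+1%:R * (err n k s)%:R <= 'C(n, k - 2)%:R :> R by rewrite -natrM ler_nat.
  rewrite -(ler_pM2l (x := eps^-1)) ?invr_gt0 // mulrA mulVf ?gt_eqF // mul1r.
  apply: le_trans leR; apply: ler_wpM2r; first exact: ler0n.
  by apply: hK; apply: leqnSn.
have [q [N1 [q0 hN1]]] := shifted_structure k2 s0.
have [N2 hN2] := @initial_shadow_asymp R k s q k2 q0.
have [X hX] := real_shadow_asymp R k2 q0 s0.
(* One threshold for both cases: k+s is what [Lovasz_EMfrom] asks of x, and X serves the case of a
   large shadow. *)
have [N3 hN3] := real_shadow_bound (Num.max X (k + s)%:R) k2 s0.
have [N4 hN4] := bin_unbounded (k - 3) N3.
exists (N1 + N2 + N4 + s + 1)%N => n nN H uH mH; rewrite ltr_nat => mlt.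
have [H' [uH' sH' cH' shH' mH']] := exists_shifted (ltnW (ltnW k2)) uH.
have C_le : ('C(n, k - 2) <= #|H'|)%N.
  rewrite cH'; apply: leq_trans (ltnW mlt); apply: leq_trans (leq_addr _ _).
  by rewrite leq_pmull // (leq_trans _ (cks_ge k2 s0)) // muln_gt0 s0 addn1.
have N3H : (N3 <= #|H'|)%N.
  apply: leq_trans C_le; have := hN4 n; rewrite (_ : (k - 3).+1 = k - 2)%N; last by lia.
  by apply; lia.
have L_init := Lcolex_initial #|H| (EM1 n k s).
have L_card := card_Lcolex #|H| (EM1 n k s); rewrite -cH' in L_card L_init.
have dich : H' \subset EMfrom n 0 k s \/ (q.+1 * #|H'| <= q * (s * #|shadow k H'|))%N.
  apply: hN1 => //; first by lia.
    exact: leq_trans mH' mH.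
  rewrite cH'; apply: leq_ltn_trans mlt.
  by rewrite leq_add2r leq_mul2r cks_ge ?orbT.
have sn : (s <= n)%N by lia.
have n0 : (0 < n)%N by lia.
(* The shifted H' has the size of H and no larger shadow, so bounds for H' carry over. *)
suff [le_colex le_real] : (#|shadow k (Lcolex #|H'| (EM1 n k s))| <= #|shadow k H'|)%N
    /\ forall x : R, #|H'|%:R = binomr x k - binomr (x - s%:R) k ->
       binomr x (k - 1) <= #|shadow k H'|%:R.
  rewrite -cH'; split; first exact: leq_trans le_colex shH'.
  by move=> x /le_real le; apply: (le_trans le); rewrite ler_nat.
case: dich => [HE|Hq]; split.
- rewrite -EMfrom0 in L_init L_card *.
  exact: Kruskal_Katona_EMfrom HE sH' L_init L_card.
(* Every member meets {0, ..., s-1}, so |H'| is at most s times the link of 0, which embeds in the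
   shadow. *)
- have crude : (#|H'| <= s * #|shadow k H'|)%N.
    pose x0 := Ordinal n0.
    have := @hitting_le n H' x0 sH' erefl s sn.
    have -> : hitting H' s = H'.
      apply/setP => A; rewrite inE andb_idr // => /(subsetP HE)/EMfromP[_ [i iA si] _].
      by apply/set0Pn; exists i; rewrite !inE iA.
    move=> /leq_trans; apply; rewrite leq_mul2l; apply/orP; right.
    by apply: leq_trans (lnk_le_shadow x0 uH'); apply: leq_addr.
  move=> x mx; apply: (hN3 _ _ N3H crude x mx); rewrite ge_max => /andP[_ ksx].
  rewrite subn1; apply: (@Lovasz_EMfrom R n 0 s) => //; [exact: ltnW | by rewrite mx].
(* With L the initial segment, q*s*|shadow L| <= (q+1)|H'| <= q*s*|shadow H'|, the same q serving on
   both sides. *)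
- have := hN2 n _ _ L_init _ L_card C_le.
  move=> /(_ ltac:(lia)) le; rewrite -(leq_pmul2l s0) -(leq_pmul2l q0).
  exact: leq_trans le Hq.
- have crude : (#|H'| <= s * #|shadow k H'|)%N.
    rewrite -(leq_pmul2l q0); apply: leq_trans Hq; rewrite leq_mul2r; lia.
  move=> x mx; apply: (hN3 _ _ N3H crude x mx); rewrite ge_max => /andP[Xx _].
  exact: hX Hq x mx Xx.
Qed.
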